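(* Let $R$ be a torsion-free pre-$\lambda$ ring. Then $\tilde{\omega}: \Lambda_R^\wedge \rightarrow \Lambda_R^\wedge$ is a map of pre-$\lambda$ rings. In particular, for every $f\in\mathrm{Fil}^1 \Lambda_R^\wedge$, \[ \tilde{\omega} \left( \mathrm{Exp}_{\sigma}(f) \right)= \mathrm{Exp}_{\sigma}(\tilde{\omega}(f)).\]
   Context: Rings are commutative with $1$; torsion-free means torsion-free as an abelian group. A pre-$\lambda$ ring is a ring $R$ with a group homomorphism $\sigma_t:(R,+)\to (1+tR[[t]],\times)$, $\sigma_t(r)=\sum_{k\ge 0}(h_k\circ r)t^k$, with $h_0\circ r=1$ and $h_1\circ r=r$. A map of pre-$\lambda$ rings is a ring homomorphism commuting with all the operations $h_k\circ$. Symmetric functions: $\Lambda$ is the ring of symmetric functions over $\mathbb{Z}$ in variables $t_1,t_2,\ldots$, with elementary symmetric functions $e_i$, complete symmetric functions $h_i$ and monomial symmetric functions $m_\tau$ ($\tau$ a partition). $\Lambda_R=\Lambda\otimes_{\mathbb{Z}}R$, and $\Lambda_R^\wedge$ is its completion with respect to degree, i.e. the ring of symmetric power series $\sum_\tau r_\tau m_\tau$ ($r_\tau\in R$, possibly infinite sums over all partitions $\tau$). $\mathrm{Fil}^1\Lambda_R^\wedge$ denotes the symmetric power series with zero constant term. Pre-$\lambda$ structure on $\Lambda_R^\wedge$: for $R$ a pre-$\lambda$ ring, $\Lambda_R^\wedge$ is a pre-$\lambda$ ring by $\sigma_t\bigl(\sum_I r_I \underline{t}^I\bigr)=\prod_I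 \sigma_{t\underline{t}^I}(r_I)$, where $\underline{t}^I$ ranges over monomials in $t_1,t_2,\ldots$ and $\sigma_{t\underline{t}^I}(r)=\sum_k (h_k\circ r)(\underline{t}^{I})^k t^k$. For $f\in \mathrm{Fil}^1\Lambda_R^\wedge$, the $\sigma$-exponential is $\mathrm{Exp}_\sigma(f)=\sum_{k\ge 0} h_k\circ f\in\Lambda_R^\wedge$. The involution $\tilde\omega$: $\omega$ is the standard $R$-algebra involution of $\Lambda_R$ swapping $e_i$ and $h_i$ for all $i$; $\tilde\omega$ is the composition of $\omega$ with the degree flip involution, which acts as $(-1)^i$ on the homogeneous component of degree $i$. It extends continuously to $\Lambda_R^\wedge$. *)

(* Defs.v *)
From HB Require Import structures.
From mathcomp Require Import all_boot all_order all_algebra.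
From mathcomp Require Import finmap multiset.
From mathcomp Require Import boolp.

Set Implicit Arguments.
Unset Strict Implicit.
Unset Printing Implicit Defensive.

Import GRing.Theory.
Local Open Scope ring_scope.

(* Commutative monoids in which every element has finitely many decompositions
   as a sum: the possible exponents of a ring of formal power series. *)
HB.mixin Record isFinDecMonoid M of Choice M := {
  madd : M -> M -> M;
  mzero : M;
  decs : M -> seq (M * M);
  maddA : associative madd;
  maddC : commutative madd;
  madd0m : left_id mzero madd;
  decs_uniq : forall m, uniq (decs m);
  mem_decs : forall m p, (p \in decs m) = (madd p.1 p.2 == m)
}.

#[short(type="fdMonoidType")]
HB.structure Definition FinDecMonoid := { M of isFinDecMonoid M & Choice M }.

Arguments mzero {s}.

Section DecsTheory.
Variables (M : fdMonoidType) (V : nmodType).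
Implicit Types m : M.

Lemma decsC m (F : M -> M -> V) :
  \sum_(p <- decs m) F p.1 p.2 = \sum_(p <- decs m) F p.2 p.1.
Proof.
pose h (p : M * M) := (p.2, p.1).
rewrite -[RHS](big_map h xpredT (fun p => F p.1 p.2)) /=; apply: perm_big.
have hK : involutive h by case.
apply: uniq_perm; rewrite ?decs_uniq // ?(map_inj_uniq (inv_inj hK)) ?decs_uniq //.
move=> p; rewrite -[in RHS](hK p) (mem_map (inv_inj hK)) !mem_decs.
by rewrite maddC.
Qed.

Lemma decsA m (F : M -> M -> M -> V) :
  \sum_(p <- decs m) \sum_(q <- decs p.1) F q.1 q.2 p.2 =
  \sum_(p <- decs m) \sum_(q <- decs p.2) F p.1 q.1 q.2.
Proof.
pose f (p q : M * M) := (q.1, q.2, p.2); pose g (p q : M * M) := (p.1, q.1, q.2).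
pose G (t : M * M * M) := F t.1.1 t.1.2 t.2.
rewrite -(@big_allpairs_dep _ _ _ _ _ _ f (decs m) (fun p => decs p.1) G).
rewrite -(@big_allpairs_dep _ _ _ _ _ _ g (decs m) (fun p => decs p.2) G).
apply: perm_big; apply: uniq_perm.
- apply: allpairs_uniq_dep => [|p _|]; rewrite ?decs_uniq //.
  move=> _ _ /allpairsPdep[p [q [_ + ->]]] /allpairsPdep[p' [q' [_ + ->]]] /=.
  rewrite !mem_decs /= => /eqP e /eqP e' [e1 e2 e3].
  by case: p q p' q' e e' e1 e2 e3 => [a b] [c d] [a' b'] [c' d'] /= <- <- -> -> ->.
- apply: allpairs_uniq_dep => [|p _|]; rewrite ?decs_uniq //.
  move=> _ _ /allpairsPdep[p [q [_ + ->]]] /allpairsPdep[p' [q' [_ + ->]]] /=.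
  rewrite !mem_decs /= => /eqP e /eqP e' [e1 e2 e3].
  by case: p q p' q' e e' e1 e2 e3 => [a b] [c d] [a' b'] [c' d'] /= <- <- -> -> ->.
case=> [[a b] c]; apply/allpairsPdep/allpairsPdep => -[p [q [+ + [-> -> ->]]]];
  rewrite !mem_decs => /eqP<- /eqP<-.
  by exists (q.1, madd q.2 p.2), (q.2, p.2); rewrite !mem_decs /= maddA !eqxx.
by exists (madd p.1 q.1, q.2), (p.1, q.1); rewrite !mem_decs /= maddA !eqxx.
Qed.

Lemma decsACA m (F : M -> M -> M -> M -> V) :
  \sum_(p <- decs m) \sum_(q <- decs p.1) \sum_(r <- decs p.2)
     F q.1 q.2 r.1 r.2 =
  \sum_(p <- decs m) \sum_(q <- decs p.1) \sum_(r <- decs p.2)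
     F q.1 r.1 q.2 r.2.
Proof.
pose E (F : M -> M -> M -> M -> V) :=
  \sum_(p <- decs m) \sum_(q <- decs p.2) \sum_(r <- decs q.2) F p.1 q.1 r.1 r.2.
have e F' : \sum_(p <- decs m) \sum_(q <- decs p.1) \sum_(r <- decs p.2)
     F' q.1 q.2 r.1 r.2 = E F'.
  by rewrite (decsA _ (fun a b c => \sum_(r <- decs c) F' a b r.1 r.2)).
rewrite e (e (fun a b c d => F a c b d)) /E; apply: eq_bigr => p _.
rewrite -(decsA _ (fun a b c => F p.1 a b c)).
rewrite -(decsA _ (fun a b c => F p.1 b a c)).
by apply: eq_bigr => q _; rewrite (decsC _ (fun a b => F p.1 a b q.2)).
Qed.

Lemma decs0 m (F : M * M -> V) :
  \sum_(p <- decs m | p.1 == mzero) F p = F (mzero, m).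
Proof.
have i : (mzero, m) \in decs m by rewrite mem_decs /= madd0m.
rewrite -big_filter (_ : [seq _ <- _ | _] = [:: (mzero, m)]) ?big_seq1 //.
apply/perm_small_eq => //; apply: uniq_perm; rewrite ?filter_uniq ?decs_uniq //.
move=> p; rewrite mem_filter mem_decs inE; case: p => a b /=.
by apply/andP/eqP => [[/eqP-> /eqP]|[-> ->]]; rewrite ?madd0m ?eqxx // => ->.
Qed.

End DecsTheory.

Record pser (M : fdMonoidType) (R : Type) := PSer { coef : M -> R }.
Arguments PSer {M R} _.
Coercion coef : pser >-> Funclass.

HB.instance Definition _ M R := gen_eqMixin (pser M R).
HB.instance Definition _ M R := gen_choiceMixin (pser M R).

Lemma pserP M R (f g : pser M R) : (forall m, f m = g m) -> f = g.
Proof. by case: f g => f [g] e; congr PSer; apply: funext. Qed.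

Section PowerSeries.
Variables (M : fdMonoidType) (R : comPzRingType).
Implicit Types f g h : pser M R.

Definition pser_zero : pser M R := PSer (fun=> 0).
Definition pser_opp f := PSer (fun m : M => - f m).
Definition pser_add f g := PSer (fun m : M => f m + g m).
Definition pser_one : pser M R := PSer (fun m => (m == mzero)%:R).
Definition pser_mul f g := PSer (fun m : M => \sum_(p <- decs m) f p.1 * g p.2).
Definition pser_scale (a : R) f := PSer (fun m : M => a * f m).

Lemma pser_addA : associative pser_add.
Proof. by move=> f g h; apply: pserP => m; apply: addrA. Qed.
Lemma pser_addC : commutative pser_add.
Proof. by move=> f g; apply: pserP => m; apply: addrC. Qed.
Lemma pser_add0 : left_id pser_zero pser_add.
Proof. by move=> f; apply: pserP => m; apply: add0r. Qed.
Lemma pser_addN : left_inverse pser_zero pser_opp pser_add.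
Proof. by move=> f; apply: pserP => m; apply: addNr. Qed.

HB.instance Definition _ := GRing.isZmodule.Build (pser M R)
  pser_addA pser_addC pser_add0 pser_addN.

Lemma pser_mulA : associative pser_mul.
Proof.
move=> f g h; apply: pserP => m /=.
under eq_bigr do rewrite mulr_sumr.
under [RHS]eq_bigr do rewrite mulr_suml.
rewrite (decsA _ (fun a b c => f a * g b * h c)).
by apply: eq_bigr => p _; apply: eq_bigr => q _; rewrite mulrA.
Qed.
Lemma pser_mulC : commutative pser_mul.
Proof.
move=> f g; apply: pserP => m /=; rewrite (decsC _ (fun a b => f a * g b)).
by apply: eq_bigr => p _; rewrite mulrC.
Qed.
Lemma pser_mul1 : left_id pser_one pser_mul.
Proof.
move=> f; apply: pserP => m /=; rewrite -[RHS](decs0 m (fun p => f p.2)) [RHS]big_mkcond.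
by apply: eq_bigr => p _; case: eqP => _; rewrite (mul1r, mul0r).
Qed.
Lemma pser_mulD : left_distributive pser_mul pser_add.
Proof.
move=> f g h; apply: pserP => m /=; rewrite -big_split /=.
by apply: eq_bigr => p _; rewrite mulrDl.
Qed.

HB.instance Definition _ := GRing.Zmodule_isComPzRing.Build (pser M R)
  pser_mulA pser_mulC pser_mul1 pser_mulD.

Lemma pser_scaleA a b f : pser_scale a (pser_scale b f) = pser_scale (a * b) f.
Proof. by apply: pserP => m; apply: mulrA. Qed.
Lemma pser_scale1 : left_id 1 pser_scale.
Proof. by move=> f; apply: pserP => m; apply: mul1r. Qed.
Lemma pser_scaleDr : right_distributive pser_scale +%R.
Proof. by move=> a f g; apply: pserP => m; apply: mulrDr. Qed.
Lemma pser_scaleDl f : {morph pser_scale^~ f : a b / a + b}.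
Proof. by move=> a b; apply: pserP => m; apply: mulrDl. Qed.

HB.instance Definition _ := GRing.Zmodule_isLmodule.Build R (pser M R)
  pser_scaleA pser_scale1 pser_scaleDr pser_scaleDl.

Lemma coef0 m : (0 : pser M R) m = 0. Proof. by []. Qed.
Lemma coefN f m : (- f) m = - f m. Proof. by []. Qed.
Lemma coefD f g m : (f + g) m = f m + g m. Proof. by []. Qed.
Lemma coef1 m : (1 : pser M R) m = (m == mzero)%:R. Proof. by []. Qed.
Lemma coefM f g m : (f * g) m = \sum_(p <- decs m) f p.1 * g p.2. Proof. by []. Qed.
Lemma coefZ a f m : (a *: f) m = a * f m. Proof. by []. Qed.
Lemma coef_sum I (s : seq I) (F : I -> pser M R) m :
  (\sum_(i <- s) F i) m = \sum_(i <- s) F i m.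
Proof. by elim/big_rec2: _ => //= i x y _ <-. Qed.

End PowerSeries.

(* Exponents of one variable *)
Definition nat_decs n : seq (nat * nat) := [seq (i, (n - i)%N) | i <- iota 0 n.+1].
Lemma nat_decs_uniq n : uniq (nat_decs n).
Proof. by rewrite map_inj_uniq ?iota_uniq // => i j []. Qed.
Lemma mem_nat_decs n p : (p \in nat_decs n) = ((p.1 + p.2)%N == n).
Proof.
case: p => a b /=; apply/mapP/eqP => [[i] | <-].
  by rewrite mem_iota ltnS => /= le_i [-> ->]; rewrite subnKC.
by exists a; rewrite ?addKn // mem_iota /= ltnS leq_addr.
Qed.
HB.instance Definition _ := isFinDecMonoid.Build nat
  addnA addnC add0n nat_decs_uniq mem_nat_decs.

(* A monomial in t_0, t_1, ... is the finite multiset of the indices of its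
   variables: I i is the exponent of t_i in t^I. *)
Local Open Scope mset_scope.
Definition monom := {mset nat}.
Identity Coercion mset_of_monom : monom >-> multiset_of.
Definition mdeg (I : monom) : nat := size I.
HB.instance Definition _ := Choice.on monom.

Fixpoint seq_decs (T : Type) (s : seq T) : seq (seq T * seq T) :=
  if s is x :: s' then
    [seq (x :: p.1, p.2) | p <- seq_decs s'] ++ [seq (p.1, x :: p.2) | p <- seq_decs s']
  else [:: ([::], [::])].

Definition mon_decs (J : monom) : seq (monom * monom) :=
  undup [seq (seq_mset p.1, seq_mset p.2) | p <- seq_decs (enum_mset J)].
Lemma mon_decs_uniq J : uniq (mon_decs J).
Proof. exact: undup_uniq. Qed.
Lemma mem_mon_decs J p : (p \in mon_decs J) = (msetD p.1 p.2 == J).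
Proof.
rewrite mem_undup -{2}[J]seq_mset_id; move: (enum_mset J) => s.
have s0 : seq_mset [::] = mset0 :> {mset nat} by apply/msetP => i; rewrite mset_seqE mset0E.
elim: s p => [|x s IH] [A B] /=.
  rewrite inE s0; apply/eqP/eqP => [[-> ->]|]; first by rewrite mset0D.
  move=> e; have eA i : A i = 0%N /\ B i = 0%N.
    by have /msetP/(_ i) := e; rewrite msetE2 mset0E; case: (A i) (B i) => [|?] [|?].
  by congr pair; apply/msetP => i; rewrite mset0E; case: (eA i).
rewrite mset_cons map_cat mem_cat -!map_comp; apply/orP/eqP => /=.
  case=> /mapP[q q_in /= [-> ->]]; rewrite mset_cons.
    rewrite -msetDA; congr (_ `+` _); apply/eqP; have := IH (seq_mset q.1, seq_mset q.2).
    by rewrite /= => <-; apply/mapP; exists q.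
  rewrite msetDCA; congr (_ `+` _); apply/eqP; have := IH (seq_mset q.1, seq_mset q.2).
  by rewrite /= => <-; apply/mapP; exists q.
move=> e; have /msetP/(_ x) := e; rewrite !msetE2 msetnxx => ex.
have [/msetB1K eA|/mset_eq0P nA] := boolP (x \in A).
  left; have e1 : (A `\ x) `+` B = seq_mset s.
    by rewrite -(msetD1K x (seq_mset s)) -e -{2}eA -msetDA msetD1K.
  have := IH (A `\ x, B); rewrite /= e1 eqxx => /mapP[q qin [e2 e3]].
  by apply/mapP; exists q => //=; rewrite mset_cons -e2 eA e3.
have /msetB1K eB : x \in B by rewrite in_mset; rewrite nA add0n in ex; rewrite ex.
right; have e1 : A `+` (B `\ x) = seq_mset s.
  by rewrite -(msetD1K x (seq_mset s)) -e -{2}eB msetDCA msetD1K.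
have := IH (A, B `\ x); rewrite /= e1 eqxx => /mapP[q qin [e2 e3]].
by apply/mapP; exists q => //=; rewrite mset_cons -e3 eB e2.
Qed.
HB.instance Definition _ := isFinDecMonoid.Build monom
  (@msetDA nat : associative (_ : monom -> monom -> monom)) (@msetDC nat) (@mset0D nat) mon_decs_uniq mem_mon_decs.
Local Close Scope mset_scope.

Definition mperm (s : nat -> nat) (I : monom) : monom := seq_mset (map s (enum_mset I)).

Section Mperm.
Local Open Scope mset_scope.
Implicit Types (s : nat -> nat) (I J : monom).

Lemma mpermK s s' : cancel s s' -> cancel (mperm s) (mperm s').
Proof.
move=> sK I; rewrite -[RHS]seq_mset_id /mperm; apply/eq_seq_msetP.
by rewrite (perm_trans (perm_map _ (perm_eq_seq_mset _))) // -map_comp (eq_map sK) map_id.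
Qed.

Lemma mpermD s I J : mperm s (madd I J) = madd (mperm s I) (mperm s J).
Proof.
apply/msetP => i; rewrite msetE2 !mset_seqE !count_map -count_cat.
apply/permP; apply/allP => j _ /=; rewrite count_cat !count_mem_mset.
by rewrite msetE2.
Qed.

Lemma mperm0 s : mperm s mzero = mzero.
Proof. by rewrite /mperm enum_mset0; apply/msetP => i; rewrite mset_seqE mset0E. Qed.

Lemma mdeg_mperm s I : mdeg (mperm s I) = mdeg I.
Proof. by rewrite /mdeg /mperm (perm_size (perm_eq_seq_mset _)) size_map. Qed.

Lemma mdegD I J : mdeg (madd I J) = (mdeg I + mdeg J)%N.
Proof.
rewrite /mdeg -size_cat; apply/perm_size/allP => j _ /=.
by rewrite count_cat !count_mem_mset msetE2.
Qed.

Lemma mdeg0 : mdeg mzero = 0%N.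
Proof. exact: size_mset0. Qed.

Lemma mdeg_eq0 I : (mdeg I == 0%N) = (I == mzero).
Proof. exact: size_mset_eq0. Qed.

Lemma maddI I : injective (madd I).
Proof. by move=> A B /(congr1 (msetB^~ I)); rewrite !(maddC I) !msetDKBC. Qed.

Lemma decs_mperm s s' J : cancel s s' -> cancel s' s ->
  perm_eq (decs (mperm s J)) [seq (mperm s p.1, mperm s p.2) | p <- decs J].
Proof.
move=> sK s'K; have sI := can_inj (mpermK sK).
have pI : injective (fun p : monom * monom => (mperm s p.1, mperm s p.2)).
  by move=> [a b] [c d] [/sI-> /sI->].
apply: uniq_perm; rewrite ?(map_inj_uniq pI) ?decs_uniq // => -[a b].
rewrite mem_decs /=; apply/eqP/mapP => [e | [[c d]]]; last first.
  by rewrite mem_decs => /eqP<- [-> ->]; rewrite mpermD.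
exists (mperm s' a, mperm s' b); rewrite /= ?(mpermK s'K) //.
by rewrite mem_decs /= -mpermD e mpermK.
Qed.

End Mperm.

Section Symmetric.
Variable R : comPzRingType.
Implicit Types f g : pser monom R.

Definition pser_perm (s : nat -> nat) f : pser monom R := PSer (fun J => f (mperm s J)).

Definition symmetric_ser f : Prop :=
  forall s : nat -> nat, bijective s -> pser_perm s f = f.

Lemma pser_permM s f g : bijective s ->
  pser_perm s (f * g) = pser_perm s f * pser_perm s g.
Proof.
case=> s' sK s'K; apply: pserP => J; rewrite /= (perm_big _ (decs_mperm J sK s'K)).
by rewrite big_map.
Qed.

Lemma pser_perm1 s : bijective s -> pser_perm s 1 = 1.
Proof.
case=> s' sK s'K; apply: pserP => J /=; congr (_%:R).
by congr nat_of_bool; rewrite -{1}(mperm0 s) (inj_eq (can_inj (mpermK sK))).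
Qed.

Definition sym_pred : {pred pser monom R} := fun f => `[< symmetric_ser f >].

Lemma sym_subring : subring_closed sym_pred.
Proof.
split=> [|f g /asboolP sf /asboolP sg|f g /asboolP sf /asboolP sg];
  apply/asboolP => s sb; first exact: pser_perm1.
  apply: pserP => J; rewrite /= -{2}(sf _ sb) -{2}(sg _ sb) //.
by rewrite pser_permM // sf // sg.
Qed.

Lemma sym_scaler : scaler_closed sym_pred.
Proof.
move=> a f /asboolP sf; apply/asboolP => s sb.
by apply: pserP => J; rewrite /= -{2}(sf _ sb).
Qed.

HB.instance Definition _ := GRing.isSubringClosed.Build _ sym_pred sym_subring.
HB.instance Definition _ := GRing.isScaleClosed.Build _ _ sym_pred sym_scaler.

(* The completion, with respect to the degree, of symmetric functions over R *)
Record symser := SymSer { sser :> pser monom R; _ : sser \in sym_pred }.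
HB.instance Definition _ := [isSub for sser].
HB.instance Definition _ := [Choice of symser by <:].
HB.instance Definition _ := GRing.SubChoice_isSubComPzRing.Build _ _ symser sym_subring.
HB.instance Definition _ := [SubZmodule_isSubLmodule of symser by <:].

Lemma symserP (F : symser) (s : nat -> nat) I : bijective s -> F (mperm s I) = F I.
Proof. by case: F => f /asboolP sf sb /=; rewrite -{2}(sf s sb). Qed.

End Symmetric.
Arguments sym_pred : clear implicits.

(* sigma_t(r), with coefficients h_k o r, as an element of A[[t]] *)
Definition sigma_t (A : Type) (h : nat -> A -> A) (r : A) : pser nat A := PSer (h^~ r).

HB.mixin Record isPreLambda R of GRing.ComPzRing R := {
  hop : nat -> R -> R;
  hop0 : forall r, hop 0 r = 1;
  hop1 : forall r, hop 1 r = r;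
  hopD : forall r s, sigma_t hop (r + s) = sigma_t hop r * sigma_t hop s
}.

#[short(type="preLambdaRingType")]
HB.structure Definition PreLambdaRing := { R of isPreLambda R & GRing.ComPzRing R }.

Definition prelambda_map (R S : preLambdaRingType) (phi : R -> S) : Prop :=
  [/\ GRing.nmod_morphism phi, GRing.monoid_morphism phi &
      forall k r, phi (hop k r) = hop k (phi r)].

Section LambdaPreLambda.
Variable R : preLambdaRingType.
Implicit Types (f g : pser monom R) (I J : monom).

Definition mexp I k : monom := iter k (madd I) mzero.

(* sigma_{t t^I}(r), as an element of R[[t_0, t_1, ...]][[t]] *)
Definition sigma_at I (r : R) : pser nat (pser monom R) :=
  PSer (fun k => PSer (fun J => if J == mexp I k then hop k r else 0)).

Definition mdivisors J : seq monom := undup (map fst (decs J)).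

(* The coefficient of t^k t^J in the product of sigma_{t t^I}(f_I) over all
   monomials I: only the finitely many I dividing J contribute, see
   hop_ser_stable. *)
Definition hop_ser k f : pser monom R :=
  PSer (fun J => (\prod_(I <- mdivisors J) sigma_at I (f I)) k J).

Lemma mem_mdivisors I J : reflect (exists K, madd I K = J) (I \in mdivisors J).
Proof.
rewrite mem_undup; apply: (iffP mapP) => [[[a b]]|[K e]].
  by rewrite mem_decs => /eqP e ->; exists b.
by exists (I, K) => //; rewrite mem_decs /= e.
Qed.

Lemma sigma_at0 I r : sigma_at I r 0%N = 1.
Proof. by apply: pserP => J /=; rewrite hop0 /mexp /=; case: eqP. Qed.

Definition eqmod J (u v : pser nat (pser monom R)) :=
  forall k A, A \in mdivisors J -> u k A = v k A.

Lemma coefMM (u v : pser nat (pser monom R)) k A :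
  (u * v) k A = \sum_(p <- decs k) \sum_(q <- decs A) u p.1 q.1 * v p.2 q.2.
Proof. by rewrite coefM coef_sum; apply: eq_bigr => p _; rewrite coefM. Qed.

Lemma mdivisors_trans A B J : A \in mdivisors B -> B \in mdivisors J -> A \in mdivisors J.
Proof.
by move=> /mem_mdivisors[K <-] /mem_mdivisors[L <-]; apply/mem_mdivisors; exists (madd K L); rewrite maddA.
Qed.

Lemma mdivisors_decs p J : p \in decs J -> (p.1 \in mdivisors J) /\ (p.2 \in mdivisors J).
Proof.
rewrite mem_decs => /eqP <-; split; apply/mem_mdivisors; first by exists p.2.
by exists p.1; rewrite maddC.
Qed.

Lemma eqmodM J u u' v v' : eqmod J u u' -> eqmod J v v' -> eqmod J (u * v) (u' * v').
Proof.
move=> eu ev k A dA; rewrite !coefMM; apply: eq_bigr => p _.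
rewrite big_seq [RHS]big_seq; apply: eq_bigr => q /mdivisors_decs[d1 d2].
by rewrite eu ?ev //; apply: (mdivisors_trans _ dA).
Qed.

Lemma sigma_at_eqmod I J r : I \notin mdivisors J -> eqmod J (sigma_at I r) 1.
Proof.
move=> nd [|k] A dA; first by rewrite sigma_at0.
rewrite coef1 /=; case: eqP => // eA; case/negP: nd.
apply: mdivisors_trans dA; apply/mem_mdivisors; exists (mexp I k).
by rewrite eA.
Qed.

Lemma prod_eqmod J (D : seq monom) f : eqmod J (\prod_(I <- D) sigma_at I (f I))
  (\prod_(I <- D | I \in mdivisors J) sigma_at I (f I)).
Proof.
elim: D => [|I D IH]; first by rewrite !big_nil.
rewrite !big_cons; case: ifPn => dI; first exact: eqmodM.
rewrite -[X in eqmod _ _ X]mul1r; apply: eqmodM => //; exact: sigma_at_eqmod.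
Qed.

Lemma mdivisors_refl J : J \in mdivisors J.
Proof. by apply/mem_mdivisors; exists mzero; rewrite maddC madd0m. Qed.

Lemma hop_ser_stable k f J (D : seq monom) : uniq D -> {subset mdivisors J <= D} ->
  (\prod_(I <- D) sigma_at I (f I)) k J = hop_ser k f J.
Proof.
move=> uD sD; rewrite (@prod_eqmod J D f k J) ?mdivisors_refl //= -big_filter; congr (coef (coef _ _) _).
apply: perm_big; apply: uniq_perm; rewrite ?filter_uniq ?undup_uniq // => I.
by rewrite mem_filter; apply/andP/idP => [[]|dI] //; split => //; apply: sD.
Qed.

Lemma hop_serD k f g : hop_ser k (f + g) =
  \sum_(p <- decs k) hop_ser p.1 f * hop_ser p.2 g.
Proof.
apply: pserP => J; rewrite coef_sum /=.
have sD I r r' : sigma_at I (r + r') = sigma_at I r * sigma_at I r'.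
  apply: pserP => n; apply: pserP => A; rewrite coefMM /=.
  have := hopD r r' => /(congr1 (fun u => coef u n)); rewrite coefM /= => ->.
  have mexpD i j : mexp I (madd i j) = madd (mexp I i) (mexp I j).
    elim: i => [|i IH]; first by rewrite -[LHS]/(mexp I j) madd0m.
    by rewrite -[LHS]/(madd I (mexp I (madd i j))) IH maddA.
  have [->|nA] := eqVneq A (mexp I n).
    rewrite big_seq [RHS]big_seq; apply: eq_bigr => -[i j].
    rewrite mem_decs => /eqP /= en.
    have pin : (mexp I i, mexp I j) \in decs (mexp I n) by rewrite mem_decs /= -mexpD en.
    rewrite (bigD1_seq _ pin (decs_uniq _)) /= !eqxx big1 ?addr0 // => -[a b] /= ne.
    case: eqP => ea; rewrite ?mul0r //; case: eqP => eb; rewrite ?mulr0 //.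
    by rewrite ea eb eqxx in ne.
  rewrite big_seq big1 // => -[i j]; rewrite mem_decs /= => /eqP en.
  rewrite big_seq big1 // => -[a b]; rewrite mem_decs /= => /eqP eA.
  case: eqP => ea; rewrite ?mul0r //; case: eqP => eb; rewrite ?mulr0 //.
  by rewrite -eA ea eb -mexpD en eqxx in nA.
under eq_bigr do rewrite sD.
rewrite big_split /= coefMM; apply: eq_bigr => p _.
rewrite /= big_seq [RHS]big_seq; apply: eq_bigr => q /mdivisors_decs[d1 d2].
by rewrite !hop_ser_stable ?undup_uniq // => A dA; apply: mdivisors_trans dA _.
Qed.

Lemma tcoefM0 (u v : pser nat (pser monom R)) : (u * v) 0%N = u 0%N * v 0%N.
Proof. by rewrite coefM big_seq1. Qed.

Lemma tcoefM1 (u v : pser nat (pser monom R)) :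
  (u * v) 1%N = u 0%N * v 1%N + u 1%N * v 0%N.
Proof. by rewrite coefM /= !big_cons big_nil addr0. Qed.

Lemma hop_ser0 f : hop_ser 0 f = 1.
Proof.
have e (D : seq monom) : (\prod_(I <- D) sigma_at I (f I)) 0%N = 1.
  elim: D => [|I D IH]; first by rewrite big_nil.
  by rewrite big_cons tcoefM0 sigma_at0 IH mul1r.
by apply: pserP => J; rewrite /hop_ser -[LHS]/(coef (coef _ _) J) e.
Qed.

Lemma hop_ser1 f : hop_ser 1 f = f.
Proof.
apply: pserP => J /=.
have e (D : seq monom) : (\prod_(I <- D) sigma_at I (f I)) 0%N = 1 /\
    (\prod_(I <- D) sigma_at I (f I)) 1%N = \sum_(I <- D) sigma_at I (f I) 1%N.
  elim: D => [|I D [IH0 IH1]]; first by rewrite !big_nil.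
  by rewrite !big_cons tcoefM0 tcoefM1 sigma_at0 IH0 IH1 !mul1r mulr1 addrC.
rewrite (e _).2 coef_sum (bigD1_seq J) ?mdivisors_refl ?undup_uniq //= hop1.
rewrite maddC madd0m eqxx big1 ?addr0 // => I nI.
by rewrite maddC madd0m eq_sym (negPf nI).
Qed.

Lemma hop_ser_sym k f : f \in sym_pred R -> hop_ser k f \in sym_pred R.
Proof.
move=> /asboolP sf; apply/asboolP => s sb; apply: pserP => J /=.
have [s' sK s'K] := sb; have mK := mpermK sK.
have -> : \prod_(I <- mdivisors (mperm s J)) sigma_at I (f I) =
          \prod_(I <- mdivisors J) sigma_at (mperm s I) (f I).
  transitivity (\prod_(I <- map (mperm s) (mdivisors J)) sigma_at I (f I)).
    apply: perm_big; apply: uniq_perm; rewrite ?(map_inj_uniq (can_inj mK)) ?undup_uniq //.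
    move=> I; apply/mem_mdivisors/mapP => [[K e]|[A /mem_mdivisors[K <-] ->]].
      exists (mperm s' I); rewrite ?(mpermK s'K) //; apply/mem_mdivisors.
      by exists (mperm s' K); rewrite -mpermD e mK.
    by exists (mperm s K); rewrite mpermD.
  by rewrite big_map; apply: eq_bigr => I _; rewrite -{2}(sf _ sb).
pose act (u : pser nat (pser monom R)) : pser nat (pser monom R) :=
  PSer (fun n => pser_perm s (u n)).
have actM u v : act (u * v) = act u * act v.
  apply: pserP => n; rewrite coefM -[LHS]/(pser_perm s _) coefM.
  apply: pserP => A; rewrite coef_sum /= coef_sum; apply: eq_bigr => p _.
  by rewrite -[LHS]/(pser_perm s (_ * _) A) pser_permM.
have acts I r : act (sigma_at (mperm s I) r) = sigma_at I r.
  apply: pserP => n; apply: pserP => A /=.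
  have -> : mexp (mperm s I) n = mperm s (mexp I n).
    by elim: n => [|n IH] /=; rewrite ?mperm0 // IH mpermD.
  by rewrite (inj_eq (can_inj mK)).
rewrite -[LHS]/(act _ k J); congr (coef (coef _ k) J).
have act1 : act 1 = 1.
  apply: pserP => n; rewrite -[LHS]/(pser_perm s (coef 1 n)) coef1.
  by case: (n == mzero); [apply: pser_perm1 | apply: pserP].
elim: (mdivisors J) => [|I D IH]; first by rewrite [in LHS]big_nil [RHS]big_nil act1.
by rewrite [in LHS]big_cons [RHS]big_cons actM acts IH.
Qed.

Definition hop_symser k (F : symser R) : symser R :=
  SymSer (hop_ser_sym k (valP F)).

Lemma hop_symser0 F : hop_symser 0 F = 1.
Proof. by apply: val_inj; apply: hop_ser0. Qed.
Lemma hop_symser1 F : hop_symser 1 F = F.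
Proof. by apply: val_inj; rewrite /= hop_ser1. Qed.
Lemma hop_symserD F G :
  sigma_t hop_symser (F + G) = sigma_t hop_symser F * sigma_t hop_symser G.
Proof.
apply: pserP => k; apply: val_inj; rewrite coefM raddf_sum.
exact: hop_serD.
Qed.

HB.instance Definition _ := isPreLambda.Build (symser R)
  hop_symser0 hop_symser1 hop_symserD.

End LambdaPreLambda.

(* Existence of the involution exchanging e_i and h_i: up to the signs (-1)^i
   in degree i, it is given by the antipode of quasi-symmetric functions, that
   is, the coefficient of the image of f at a monomial J is the signed sum of
   the coefficients of f over the refinements of the sequence of exponents of J. *)
Section Antipode.
Variable R : comPzRingType.
Implicit Types (F G : seq nat -> R) (P : seq nat -> seq nat -> R).

Fixpoint compositions_rec (fuel j : nat) : seq (seq nat) :=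
  if j == 0%N then [:: [::]] else
  if fuel is fuel'.+1 then
    [seq b :: a | b <- iota 1 j, a <- compositions_rec fuel' (j - b)]
  else [::].
Definition compositions j := compositions_rec j j.

Lemma compositions_recS n j : compositions_rec n.+1 j.+1 =
  [seq b :: a | b <- iota 1 j.+1, a <- compositions_rec n (j.+1 - b)].
Proof. by []. Qed.

Lemma compositions_recE n m j : (j <= n)%N -> (j <= m)%N ->
  compositions_rec n j = compositions_rec m j.
Proof.
elim: n m j => [|n IH] [|m] [|j] // jn jm; rewrite !compositions_recS.
congr flatten; apply/eq_in_map => b; rewrite mem_iota => /andP[b0 _].
have le_b : (j.+1 - b <= j)%N by rewrite leq_subLR -add1n leq_add2r.
by congr map; apply: IH; apply: leq_trans le_b _.
Qed.

Lemma compositions0 : compositions 0 = [:: [::]]. Proof. by []. Qed.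
Lemma compositionsS j : compositions j.+1 =
  [seq b :: a | b <- iota 1 j.+1, a <- compositions (j.+1 - b)].
Proof.
rewrite {1}/compositions compositions_recS.
congr flatten; apply/eq_in_map => b; rewrite mem_iota => /andP[b0 _].
by congr map; apply: compositions_recE; rewrite // leq_subLR -add1n leq_add2r.
Qed.

Lemma compositionsP j a : a \in compositions j -> sumn a = j /\ all (leq 1) a.
Proof.
have [n] := ubnP j; elim: n j a => // n IH [|j] a; first by rewrite inE => _ /eqP->.
rewrite ltnS compositionsS => jn /allpairsPdep[b [c [+ + ->]]].
rewrite mem_iota add1n ltnS => /andP[b0 bj] /IH[|/= -> ->]; last by rewrite b0 subnKC.
by apply: leq_ltn_trans jn; rewrite leq_subLR -add1n leq_add2r.
Qed.

Definition alt j F := \sum_(a <- compositions j) (-1) ^+ size a * F a.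

Lemma alt0 F : alt 0 F = F [::].
Proof. by rewrite /alt big_seq1 expr0 mul1r. Qed.

Lemma eq_alt j F G : (forall a, sumn a = j -> all (leq 1) a -> F a = G a) -> alt j F = alt j G.
Proof.
by move=> e; rewrite /alt big_seq [RHS]big_seq; apply: eq_bigr => a /compositionsP[s p]; rewrite e.
Qed.

Lemma alt_sum (I : Type) (s : seq I) j (F : I -> seq nat -> R) :
  alt j (fun a => \sum_(i <- s) F i a) = \sum_(i <- s) alt j (F i).
Proof.
rewrite /alt exchange_big /=; apply: eq_bigr => a _.
by rewrite mulr_sumr.
Qed.

Lemma altZ j c F : alt j (fun a => c * F a) = c * alt j F.
Proof. by rewrite /alt mulr_sumr; apply: eq_bigr => a _; rewrite mulrCA. Qed.

Lemma altC i j P : alt i (fun a => alt j (P a)) = alt j (fun b => alt i (P^~ b)).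
Proof.
rewrite {1}/alt (eq_bigr (fun a => alt j (fun b => (-1) ^+ size a * P a b))); last first.
  by move=> a _; rewrite altZ.
rewrite -alt_sum; apply: eq_alt => b _ _ //.
Qed.

Lemma alt_rec j F : (forall a, F (0%N :: a) = F a) ->
  \sum_(p <- decs j) alt p.2 (fun a => F (p.1 :: a)) = if j == 0%N then F [::] else 0.
Proof.
move=> F0; rewrite [decs j]/(nat_decs j) big_map /= big_cons subn0.
case: j => [|j] /=; first by rewrite big_nil addr0 alt0 F0.
rewrite [X in X + _](eq_alt (G := F)) // [X in X + _]/alt compositionsS.
rewrite big_allpairs_dep /= -big_split /= big1_seq // => b _.
rewrite /alt -big_split big1 //= => a _.
by rewrite exprS mulN1r mulNr addNr.
Qed.

Fixpoint nat_splits (l : seq nat) : seq (seq nat * seq nat) :=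
  if l is a :: l' then
    [seq (x.1 :: p.1, x.2 :: p.2) | x <- decs a, p <- nat_splits l']
  else [:: ([::], [::])].

Definition lmul F G l := \sum_(p <- nat_splits l) F p.1 * G p.2.

Lemma big_splits_cons a l (E : seq nat * seq nat -> R) : \sum_(p <- nat_splits (a :: l)) E p =
  \sum_(x <- decs a) \sum_(p <- nat_splits l) E (x.1 :: p.1, x.2 :: p.2).
Proof. exact: big_allpairs_dep. Qed.

Lemma big_splits_cat k l (E : seq nat * seq nat -> R) : \sum_(p <- nat_splits (k ++ l)) E p =
  \sum_(q <- nat_splits k) \sum_(p <- nat_splits l) E (q.1 ++ p.1, q.2 ++ p.2).
Proof.
elim: k E => [|a k IH] E; first by rewrite big_seq1; apply: eq_bigr => -[].
rewrite cat_cons !big_splits_cons; apply: eq_bigr => x _.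
by rewrite IH; apply: eq_bigr => q _.
Qed.

Definition zinv2 P := (forall k l c, P (k ++ 0%N :: l) c = P (k ++ l) c) /\
  (forall b k l, P b (k ++ 0%N :: l) = P b (k ++ l)).

Lemma alt_splits j P : zinv2 P ->
  alt j (fun a => \sum_(p <- nat_splits a) P p.1 p.2) =
  \sum_(x <- decs j) alt x.1 (fun b => alt x.2 (fun c => P b c)).
Proof.
pose L P j := alt j (fun a => \sum_(p <- nat_splits a) P p.1 p.2).
pose K P j := \sum_(x <- decs j) alt x.1 (fun b => alt x.2 (fun c => P b c)).
pose P' P (q : nat * nat) := fun b c => P (q.1 :: b) (q.2 :: c).
have zP' Q q : zinv2 Q -> zinv2 (P' Q q).
  case=> z1 z2; split=> [k l c|b k l]; rewrite /P'.
    by rewrite -!cat_cons z1.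
  by rewrite -!cat_cons z2.
pose C H Q m : R := \sum_(p <- decs m) \sum_(q <- decs p.1) H (P' Q q) p.2.
have CL Q m : zinv2 Q -> C L Q m = if m == 0%N then Q [::] [::] else 0.
  move=> [z1 z2]; have := @alt_rec m (fun a => \sum_(p <- nat_splits a) Q p.1 p.2).
  rewrite big_seq1 => <-.
    apply: eq_bigr => p _; rewrite /L -alt_sum; apply: eq_alt => a _ _.
    by rewrite big_splits_cons.
  move=> a; rewrite big_splits_cons big_seq1; apply: eq_bigr => p _ /=.
  by rewrite (z1 [::]) (z2 _ [::]).
have CK Q m : zinv2 Q -> C K Q m = if m == 0%N then Q [::] [::] else 0.
  move=> [z1 z2]; rewrite /C /K.
  rewrite (decsACA m (fun a b c d => alt c (fun b' => alt d (fun c' => Q (a :: b') (b :: c'))))).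
  have e (p : nat * nat) : \sum_(q <- decs p.1) \sum_(r <- decs p.2)
      alt q.2 (fun b' => alt r.2 (fun c' => Q (q.1 :: b') (r.1 :: c'))) =
      if p.1 == 0%N then if p.2 == 0%N then Q [::] [::] else 0 else 0.
    under eq_bigr => q _.
      rewrite -alt_sum.
      rewrite (eq_alt (G := fun b' => if p.2 == 0%N then Q (q.1 :: b') [::] else 0)); last first.
        by move=> a _ _; apply: (@alt_rec p.2 (Q (q.1 :: a))) => c; apply: (z2 _ [::]).
      over.
    rewrite (@alt_rec p.1 (fun b => if p.2 == 0%N then Q b [::] else 0)) // => b.
    by rewrite (z1 [::]).
  rewrite (eq_bigr _ (fun p _ => e p)) {e}.
  rewrite (eq_bigr (fun p : nat * nat => if p.1 == mzero then if p.2 == 0%N then Q [::] [::] else 0 else 0)) //.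
  by rewrite -big_mkcond (decs0 m (fun p => if p.2 == 0%N then Q [::] [::] else 0)).
rewrite -/(L P j) -[RHS]/(K P j).
have [n] := ubnP j; elim: n j P => // n IH j Q jn zQ.
have := CK Q j zQ; rewrite -CL // /C.
rewrite [X in X = _](bigID (fun p : nat * nat => p.1 == 0%N)) /=.
rewrite [X in _ = X](bigID (fun p : nat * nat => p.1 == 0%N)) /=.
rewrite (decs0 j (fun p => \sum_(q <- decs p.1) K (P' Q q) p.2)).
rewrite (decs0 j (fun p => \sum_(q <- decs p.1) L (P' Q q) p.2)).
rewrite [X in _ + X = _](_ : _ = \sum_(p <- decs j | p.1 != 0%N) \sum_(q <- decs p.1) L (P' Q q) p.2); last first.
  rewrite big_seq_cond [RHS]big_seq_cond; apply: eq_bigr => -[a b] /andP[].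
  rewrite mem_decs /= => /eqP e a0; apply: eq_bigr => q _; rewrite IH //; last exact: zP'.
  rewrite -ltnS; apply: leq_trans jn; rewrite ltnS -e -lt0n in a0 *.
  by rewrite -add1n leq_add2r.
move/addIr; rewrite /= !big_seq1 => e.
case: zQ => z1 z2; have eQ b c : P' Q (0%N, 0%N) b c = Q b c.
  by rewrite /P' /= (z1 [::]) (z2 _ [::]).
transitivity (L (P' Q (0%N, 0%N)) j).
  by apply: eq_alt => a _ _; apply: eq_bigr => p _; rewrite eQ.
rewrite -e; apply: eq_bigr => x _; apply: eq_alt => b _ _; apply: eq_alt => c _ _.
exact: eQ.
Qed.

Fixpoint antip F (js : seq nat) : R :=
  if js is j :: js' then alt j (fun a => antip (fun l => F (a ++ l)) js')
  else F [::].

Lemma eq_antip js F G : (forall l, sumn l = sumn js -> all (leq 1) l -> F l = G l) ->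
  antip F js = antip G js.
Proof.
elim: js F G => [|j js IH] F G e /=; first exact: e.
apply: eq_alt => a sa pa; apply: IH => l sl pl; apply: e.
  by rewrite sumn_cat sa sl.
by rewrite all_cat pa.
Qed.

Lemma antip_sum (I : Type) (s : seq I) (F : I -> seq nat -> R) js :
  antip (fun l => \sum_(i <- s) F i l) js = \sum_(i <- s) antip (F i) js.
Proof.
elim: js F => //= j js IH F; rewrite -alt_sum; apply: eq_alt => a _ _; exact: IH.
Qed.

Lemma antipZ c F js : antip (fun l => c * F l) js = c * antip F js.
Proof.
elim: js F => //= j js IH F; rewrite -altZ; apply: eq_alt => a _ _; exact: IH.
Qed.

Definition zinv F := forall k l, F (k ++ 0%N :: l) = F (k ++ l).

Lemma zinv_cat F a : zinv F -> zinv (fun l => F (a ++ l)).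
Proof. by move=> z k l; rewrite !catA z. Qed.

Lemma antip_zinv F : zinv (antip F).
Proof.
move=> k l; elim: k F => [|j k IH] F /=; first by rewrite alt0.
by apply: eq_alt => a _ _; apply: IH.
Qed.

Lemma antip_zinvF F k l js : zinv F ->
  antip (fun m => F ((k ++ 0%N :: l) ++ m)) js = antip (fun m => F ((k ++ l) ++ m)) js.
Proof. by move=> z; apply: eq_antip => m _ _; rewrite -!catA z. Qed.

Lemma antipM F G js : zinv F -> zinv G -> antip (lmul F G) js = lmul (antip F) (antip G) js.
Proof.
elim: js F G => [|j js IH] F G zF zG /=; first by rewrite /lmul /= !big_seq1.
rewrite /lmul big_splits_cons.
transitivity (alt j (fun a => \sum_(p <- nat_splits a)
    lmul (antip (fun l => F (p.1 ++ l))) (antip (fun l => G (p.2 ++ l))) js)).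
  apply: eq_alt => a _ _; rewrite [RHS](eq_bigr (fun p => antip (lmul
    (fun l => F (p.1 ++ l)) (fun l => G (p.2 ++ l))) js)) => [|p _].
    by rewrite -antip_sum; apply: eq_antip => l _ _; rewrite /lmul big_splits_cat.
  by rewrite IH //; apply: zinv_cat.
rewrite (alt_splits _ (P := fun b c => lmul (antip (fun l => F (b ++ l))) (antip (fun l => G (c ++ l))) js)).
  apply: eq_bigr => x _ /=; rewrite /lmul.
  under eq_alt => b _ _ do rewrite alt_sum.
  rewrite alt_sum; apply: eq_bigr => p _.
  under eq_alt => b _ _ do rewrite altZ mulrC.
  by rewrite altZ mulrC.
by split=> [k l c|b k l]; apply: eq_bigr => p _; rewrite antip_zinvF.
Qed.

Lemma antip_swap F k a b l : (forall k a b l, F (k ++ a ++ b ++ l) = F (k ++ b ++ a ++ l)) ->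
  antip F (k ++ a :: b :: l) = antip F (k ++ b :: a :: l).
Proof.
move=> sF; elim: k F sF => [|j k IH] F sF /=.
  rewrite altC; apply: eq_alt => c _ _; apply: eq_alt => d _ _.
  by apply: eq_antip => m _ _; apply: (sF [::]).
by apply: eq_alt => c _ _; apply: IH => k' a' b' l'; rewrite !(catA c).
Qed.

End Antipode.

Lemma perm_swap_ind (T : eqType) (V : Type) (G : seq T -> V) :
  (forall k a b l, G (k ++ a :: b :: l) = G (k ++ b :: a :: l)) ->
  forall l l', perm_eq l l' -> G l = G l'.
Proof.
move=> sG l l' pl; rewrite -[l]cat0s -[l']cat0s; move: [::] => k.
have mv k' x l1 l2 : G (k' ++ x :: l1 ++ l2) = G (k' ++ l1 ++ x :: l2).
  elim: l1 k' => //= y l1 IH k'; rewrite sG.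
  by have := IH (rcons k' y); rewrite !cat_rcons.
elim: l l' k pl => [|x l IH] l' k pl.
  by move: pl; rewrite perm_sym => /perm_nilP ->.
have : x \in l' by rewrite -(perm_mem pl) inE eqxx.
move=> xl'; case/splitPr: l' / xl' pl => l1 l2 pl.
rewrite -mv -!cat_rcons; apply: IH.
by rewrite -(perm_cons x) (perm_trans pl) // perm_catC /= perm_cons perm_catC.
Qed.

Section MonomialOfExponents.
Implicit Types (r p : seq nat) (J : monom).
Local Open Scope mset_scope.

Fixpoint mon_at r p : monom :=
  match r, p with
  | i :: r', a :: p' => msetn a i `+` mon_at r' p'
  | _, _ => mset0
  end.

Lemma mon_atE r p i : uniq r -> size p = size r -> mon_at r p i = nth 0%N p (index i r).
Proof.
elim: r p => [|j r IH] [|a p] //=; first by rewrite mset0E.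
case/andP=> jr ur [sp]; rewrite msetE2 msetnE IH // [j == i]eq_sym.
case: eqP => [->|_] //=; rewrite nth_default ?addn0 //.
by move: jr; rewrite -index_mem -leqNgt sp.
Qed.

Lemma mon_at_map r J : uniq r -> {subset finsupp J <= r} -> mon_at r [seq J i | i <- r] = J.
Proof.
move=> ur sr; apply/msetP => i; rewrite mon_atE ?size_map //.
have [ir|nir] := boolP (i \in r); first by rewrite (nth_map 0%N) ?index_mem // nth_index.
rewrite nth_default; last by rewrite size_map leqNgt index_mem.
by apply/esym/eqP; rewrite -memNfinsupp; apply: contra nir => /sr.
Qed.

Lemma map_mon_at r p : uniq r -> size p = size r -> [seq mon_at r p i | i <- r] = p.
Proof.
move=> ur sp; apply: (@eq_from_nth _ 0%N); rewrite size_map // => i ir.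
by rewrite (nth_map 0%N) // mon_atE // index_uniq.
Qed.

Lemma finsupp_mon_at r p : uniq r -> size p = size r -> {subset finsupp (mon_at r p) <= r}.
Proof.
move=> ur sp i; rewrite mem_finsupp mon_atE // -[i \in r]index_mem; apply: contraR.
by rewrite -leqNgt -sp => /(nth_default 0%N)->.
Qed.

Lemma mem_nat_splits l p q : ((p, q) \in nat_splits l) =
  [&& size p == size l, size q == size l & [seq (x.1 + x.2)%N | x <- zip p q] == l].
Proof.
elim: l p q => [|a l IH] p q; first by case: p q => [|? ?] [|? ?].
apply/allpairsPdep/and3P => [[x [u [+ + [-> ->]]]]|].
  by case: x u => b c [p' q']; rewrite mem_decs IH /= => /eqP<- /and3P[sp sq /eqP e]; rewrite !eqSS e.
case: p q => [|b p] [|c q] [] // sp sq /eqP[e1 e2]; move: sp sq; rewrite !eqSS => sp sq.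
exists (b, c), (p, q); split=> //; first by rewrite mem_decs -e1.
by rewrite IH sp sq e2 eqxx.
Qed.

Lemma nat_splits_uniq l : uniq (nat_splits l).
Proof.
elim: l => // a l IH.
apply: (@allpairs_uniq _ _ _ (fun (x : nat * nat) (p : seq nat * seq nat) =>
  (x.1 :: p.1, x.2 :: p.2))) => //; first exact: decs_uniq.
by move=> [[b c] [p q]] [[b' c'] [p' q']] _ _ /= [-> -> -> ->].
Qed.

Lemma finsupp_decs J (p : monom * monom) r : p \in decs J -> {subset finsupp J <= r} ->
  {subset finsupp p.1 <= r} /\ {subset finsupp p.2 <= r}.
Proof.
rewrite mem_decs => /eqP<- sr; split=> i; rewrite mem_finsupp => ni; apply: sr;
  by rewrite mem_finsupp msetE2 addn_eq0 negb_and ni ?orbT.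
Qed.

Lemma nat_splits_decs r J : uniq r -> {subset finsupp J <= r} ->
  perm_eq (nat_splits [seq J i | i <- r])
    [seq ([seq p.1 i | i <- r], [seq p.2 i | i <- r]) | p : monom * monom <- decs J].
Proof.
move=> ur sr; apply: uniq_perm; rewrite ?nat_splits_uniq //.
  rewrite map_inj_in_uniq ?decs_uniq // => -[A B] [C D] /finsupp_decs-/(_ _ sr)[/= sA sB].
  move=> /finsupp_decs-/(_ _ sr)[/= sC sD] [e1 e2].
  by rewrite -(mon_at_map ur sA) -(mon_at_map ur sB) e1 e2 !mon_at_map.
case=> p q; rewrite mem_nat_splits !size_map; apply/and3P/mapP => [[/eqP sp /eqP sq /eqP e]|].
  exists (mon_at r p, mon_at r q); last by rewrite /= !map_mon_at.
  rewrite mem_decs /=; apply/eqP/msetP => i; rewrite msetE2 !mon_atE //.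
  rewrite -[in RHS](mon_at_map ur sr) mon_atE ?size_map // -e.
  have [ir|ir] := ltnP (index i r) (size r).
    by rewrite (nth_map (0, 0)%N) ?nth_zip ?sp // size_zip sp sq minnn.
  by rewrite !nth_default // ?size_map ?size_zip ?sp ?sq ?minnn.
case=> -[A B]; rewrite mem_decs /= => /eqP <- [-> ->]; rewrite !size_map; split=> //.
by apply/eqP; elim: r {ur sr} => //= i r ->; rewrite msetE2.
Qed.

Lemma mdegE J r : uniq r -> {subset finsupp J <= r} -> mdeg J = sumn [seq J i | i <- r].
Proof.
move=> ur sr; rewrite /mdeg size_mset sumnE big_map [RHS](bigID (mem (finsupp J))) /=.
rewrite [X in (_ + X)%N]big1 ?addn0 => [|i]; last first.
  by rewrite -topredE /= memNfinsupp => /eqP.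
rewrite -[RHS]big_filter; apply: perm_big; apply: uniq_perm; rewrite ?filter_uniq //.
  exact: fset_uniq.
move=> i; rewrite mem_filter /=; apply/idP/andP => [h|[]] //; split=> //; exact: sr.
Qed.

Lemma uniq_monom J r : uniq r -> {subset finsupp J <= r} ->
  uniq J = all (fun a => a <= 1)%N [seq J i | i <- r].
Proof.
move=> ur sr; apply/idP/allP => [uJ _ /mapP[i _ ->]|le1].
  by rewrite -count_mem_mset count_uniq_mem // leq_b1.
apply: count_mem_uniq => i; rewrite count_mem_mset in_mset.
have [iJ|] := boolP (i \in finsupp J); last by rewrite memNfinsupp => /eqP->.
by have := le1 _ (map_f _ (sr _ iJ)); case: (J i) => [|[]].
Qed.

End MonomialOfExponents.

Section Omega.
Variable R : comPzRingType.
Implicit Types (F G : symser R) (J : monom).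

Definition Fil n F : Prop := forall J, (mdeg J < n)%N -> F J = 0.

(* h_n and e_n are the sums of all, resp. all squarefree, monomials of degree n. *)
Definition hsym_ser n : pser monom R := PSer (fun J => (mdeg J == n)%:R).
Definition esym_ser n : pser monom R := PSer (fun J => ((mdeg J == n) && uniq J)%:R).

Lemma hsym_sym n : hsym_ser n \in sym_pred R.
Proof. by apply/asboolP => s _; apply: pserP => J; rewrite /= mdeg_mperm. Qed.

Lemma esym_sym n : esym_ser n \in sym_pred R.
Proof.
apply/asboolP => s /bij_inj sI; apply: pserP => J.
by rewrite /= mdeg_mperm (perm_uniq (perm_eq_seq_mset _)) map_inj_uniq.
Qed.

Definition hsym n : symser R := SymSer (hsym_sym n).
Definition esym n : symser R := SymSer (esym_sym n).

Definition degflip_ser (f : pser monom R) : pser monom R :=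
  PSer (fun J => (-1) ^+ mdeg J * f J).

Lemma degflip_sym F : degflip_ser F \in sym_pred R.
Proof.
by apply/asboolP => s sb; apply: pserP => J; rewrite /= mdeg_mperm symserP.
Qed.

Definition degflip F : symser R := SymSer (degflip_sym F).

(* The continuous extension to the completion of the R-algebra involution of
   the ring of symmetric functions which exchanges e_i and h_i for all i. The e_i
   generate the R-algebra of symmetric functions, which is dense in the completion
   for the topology given by Fil, so at most one map has these properties; it is
   an involution because its square fixes the e_i. *)
Definition is_omega (omega : symser R -> symser R) : Prop :=
  [/\ GRing.nmod_morphism omega, GRing.monoid_morphism omega,
      forall a F, omega (a *: F) = a *: omega F,
      forall i, omega (esym i) = hsym i /\ omega (hsym i) = esym i &
      forall n, exists m, forall F, Fil m F -> Fil n (omega F)].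

Let nE m (t : seq nat) j : m = size t -> nth 0%N t (index j (iota 0 m)) = nth 0%N t j.
Proof.
move=> ->; have [jt|jt] := ltnP j (size t).
  by rewrite -{1}[j](@nth_iota 0 0 (size t)) ?add0n // index_uniq ?size_iota ?iota_uniq // nth_iota.
by rewrite [RHS]nth_default // nth_default // memNindex ?size_iota // mem_iota add0n -leqNgt.
Qed.

(* The coefficient of F at t_0^(l_0) t_1^(l_1) t_2^(l_2) *)
Let xp F (l : seq nat) : R := F (mon_at (iota 0 (size l)) l).

Lemma xp_adj F k a b l : xp F (k ++ a :: b :: l) = xp F (k ++ b :: a :: l).
Proof.
pose n := size k; pose s i := if i == n then n.+1 else if i == n.+1 then n else i.
have sK : involutive s.
  move=> i; rewrite /s; have [->|n1] := eqVneq i n; first by rewrite eqxx gtn_eqF.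
  by have [->|n2] := eqVneq i n.+1; rewrite ?eqxx // (negPf n1) (negPf n2).
rewrite /xp -(symserP F _ (inv_bij sK)); congr (coef _ _).
apply/msetP => i; rewrite mset_seqE count_map.
rewrite (eq_count (a2 := pred1 (s i))); last first.
  by move=> j; rewrite /= (can2_eq sK sK).
rewrite count_mem_mset !mon_atE ?iota_uniq ?size_iota // !nE // !nth_cat -/n /s.
have [->|n1] := eqVneq i n; first by rewrite ltnn subnn ltnNge leqnSn /= subSnn.
have [->|n2] := eqVneq i n.+1; first by rewrite ltnn subnn ltnNge leqnSn /= subSnn.
case: ltnP => // ni; have : (n < i)%N by rewrite ltn_neqAle eq_sym n1.
rewrite leq_eqVlt eq_sym (negPf n2) /= => lt_i.
have : (1 < i - n)%N by rewrite ltn_subRL addn1.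
by case: (i - n)%N => [|[|m]].
Qed.

Lemma xp_perm F l l' : perm_eq l l' -> xp F l = xp F l'.
Proof. by apply: perm_swap_ind; apply: xp_adj. Qed.

Lemma xp_zinv F : zinv (xp F).
Proof.
move=> k l; rewrite (@xp_perm F _ ((k ++ l) ++ [:: 0%N])); last first.
  by rewrite -catA perm_cat2l -cat1s perm_catC.
rewrite /xp; congr (coef _ _); set t := k ++ l; apply/msetP => i.
rewrite !mon_atE ?iota_uniq ?size_iota // !nE // nth_cat.
case: ltnP => // it; rewrite [RHS]nth_default //.
by case: (i - size t)%N => [|[]].
Qed.


Definition anti_ser F : pser monom R :=
  PSer (fun J => antip (xp F) [seq J i | i <- finsupp J]).

Lemma antip_perm F l l' : perm_eq l l' -> antip (xp F) l = antip (xp F) l'.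
Proof.
apply: perm_swap_ind => k a b t; apply: antip_swap => k' a' b' l''.
by apply: xp_perm; rewrite perm_cat2l perm_catCA.
Qed.

Lemma anti_serE F J r : uniq r -> {subset finsupp J <= r} ->
  antip (xp F) [seq J i | i <- r] = anti_ser F J.
Proof.
move=> ur sr; rewrite /anti_ser /=.
pose r1 := [seq i <- r | i \in finsupp J]; pose r2 := [seq i <- r | i \notin finsupp J].
rewrite (@antip_perm F _ ([seq J i | i <- r1] ++ [seq J i | i <- r2])); last first.
  rewrite -map_cat; apply: perm_map.
  by rewrite perm_sym; apply/permPl/perm_filterC.
have -> : [seq J i | i <- r2] = nseq (size r2) 0%N.
  rewrite -[size r2](size_map (fun i => J i)).
  apply/all_pred1P/allP => _ /mapP[i + ->].
  by rewrite mem_filter memNfinsupp => /andP[].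
have -> k l : antip (xp F) (l ++ nseq k 0%N) = antip (xp F) l.
  elim: k => [|k IH] /=; first by rewrite cats0.
  by rewrite antip_zinv.
apply/antip_perm/perm_map/uniq_perm; rewrite ?filter_uniq ?fset_uniq // => i.
by rewrite mem_filter; apply/andP/idP => [[]|h] //; split=> //; apply: sr.
Qed.

Lemma anti_sym F : anti_ser F \in sym_pred R.
Proof.
apply/asboolP => s sb; have sI := bij_inj sb; apply: pserP => J.
have sE i : mperm s J (s i) = J i.
  rewrite mset_seqE count_map -count_mem_mset; apply: eq_count => j /=.
  by rewrite (inj_eq sI).
rewrite -[LHS]/(anti_ser F (mperm s J)).
rewrite -(@anti_serE F (mperm s J) (map s (finsupp J))) ?map_inj_uniq ?fset_uniq //.
  by rewrite -map_comp (eq_map sE).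
case: sb => s' sK s'K i; rewrite mem_finsupp -{1}[i]s'K sE => ni.
by rewrite -[i]s'K map_f // mem_finsupp.
Qed.

Definition anti F : symser R := SymSer (anti_sym F).

Lemma xpM F G l : xp (F * G) l = lmul (xp F) (xp G) l.
Proof.
set r := iota 0 (size l); set J := mon_at r l.
have ur : uniq r by apply: iota_uniq.
have sl : size l = size r by rewrite size_iota.
have sr := finsupp_mon_at ur sl.
rewrite /lmul -[l in nat_splits l](map_mon_at ur sl).
rewrite (perm_big _ (nat_splits_decs ur sr)) big_map.
rewrite -[LHS]/((sser F * sser G) J) coefM big_seq [RHS]big_seq; apply: eq_bigr => -[A B].
case/finsupp_decs/(_ sr) => /= sA sB.
by rewrite /xp !size_map size_iota !mon_at_map.
Qed.

Lemma antiM F G : anti (F * G) = anti F * anti G.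
Proof.
apply: val_inj; apply: pserP => J /=; set r : seq nat := finsupp J.
have ur : uniq r by apply: fset_uniq.
have sr : {subset finsupp J <= r} by [].
rewrite (@eq_antip _ _ _ (lmul (xp F) (xp G))) => [|l _ _]; last exact: xpM.
rewrite antipM; try exact: xp_zinv.
rewrite /lmul (perm_big _ (nat_splits_decs ur sr)) big_map.
rewrite big_seq [RHS]big_seq; apply: eq_bigr => -[A B].
by case/finsupp_decs/(_ sr) => /= sA sB; rewrite !anti_serE.
Qed.

Lemma antiD F G : anti (F + G) = anti F + anti G.
Proof.
apply: val_inj; apply: pserP => J /=.
have := @antip_sum R bool [:: true; false] (fun b => xp (if b then F else G))
  [seq J i | i <- finsupp J].
rewrite !big_cons big_nil addr0 => <-.
by apply: eq_antip => l _ _; rewrite !big_cons big_nil addr0.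
Qed.

Lemma antiZ a F : anti (a *: F) = a *: anti F.
Proof.
apply: val_inj; apply: pserP => J /=; rewrite -antipZ; exact: eq_antip.
Qed.

Lemma xp_deg l : mdeg (mon_at (iota 0 (size l)) l) = sumn l.
Proof.
have ur := iota_uniq 0 (size l); have sl : size l = size (iota 0 (size l)) by rewrite size_iota.
by rewrite (mdegE ur (finsupp_mon_at ur sl)) map_mon_at.
Qed.

Lemma xp_uniq l : uniq (mon_at (iota 0 (size l)) l) = all (fun a => a <= 1)%N l.
Proof.
have ur := iota_uniq 0 (size l); have sl : size l = size (iota 0 (size l)) by rewrite size_iota.
by rewrite (uniq_monom ur (finsupp_mon_at ur sl)) map_mon_at.
Qed.

Lemma exps_gt0 J : all (leq 1) [seq J i | i <- finsupp J].
Proof. by apply/allP => _ /mapP[i + ->]; rewrite mem_finsupp lt0n. Qed.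

Lemma sumn_exps J : sumn [seq J i | i <- finsupp J] = mdeg J.
Proof. by rewrite -mdegE ?fset_uniq. Qed.

Lemma anti_Fil n F : Fil n F -> Fil n (anti F).
Proof.
move=> fF J lt_J /=; rewrite (@eq_antip _ _ _ (fun l => 0 * xp F l)) ?antipZ ?mul0r // => l sl _.
by rewrite mul0r /xp fF // xp_deg sl sumn_exps.
Qed.

Lemma anti1 : anti 1 = 1.
Proof.
apply: val_inj; apply: pserP => J /=.
rewrite -mdeg_eq0 (@eq_antip _ _ _ (fun l => (mdeg J == 0%N)%:R * 1)) => [|l sl _]; last first.
  by rewrite mulr1 -[LHS]/((1 : pser monom R) _) coef1 -mdeg_eq0 xp_deg sl sumn_exps.
rewrite antipZ; have [J0|_] := eqVneq; last by rewrite mul0r.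
have -> : [seq J i | i <- finsupp J] = [::].
  have := exps_gt0 J; have := sumn_exps J; rewrite J0.
  by case: [seq _ | _ <- _] => //= a l; case: a.
by rewrite mul1r.
Qed.

Let one1 := (fun _ : seq nat => 1 : R).
Let sqf := (fun l => (all (fun a => a <= 1)%N l)%:R : R).

Lemma alt_one j : (0 < j)%N -> alt j one1 = if j == 1%N then -1 else 0.
Proof.
case: j => // j _.
have S n : \sum_(i < n.+1) alt i one1 = (n == 0%N)%:R.
  have := @alt_rec R n one1 (fun=> erefl).
  rewrite (decsC n (fun a b => alt b (fun c => one1 (a :: c)))) [decs n]/(nat_decs n) big_map -[iota _ _]/(index_iota 0 n.+1).
  by rewrite big_mkord => e; transitivity (if n == 0%N then 1 : R else 0); last by case: eqP.
have := S j.+1; rewrite big_ord_recr /= S.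
by move/(canRL (addKr _)) => ->; rewrite addr0 eqSS; case: eqP => //; rewrite oppr0.
Qed.

Lemma antip_one js : all (leq 1) js ->
  antip one1 js = if all (pred1 1%N) js then (-1) ^+ size js else 0.
Proof.
elim: js => //= j js IH /andP[j0 /IH e].
rewrite (@eq_alt _ _ _ (fun a => antip one1 js * one1 a)) => [|a _ _]; last by rewrite mulr1.
rewrite altZ alt_one // e exprS; case: (j == 1%N); rewrite ?mulr0 //=.
by case: all; rewrite ?mul0r // mulrC.
Qed.

Lemma alt_sqf j : alt j sqf = (-1) ^+ j.
Proof.
elim: j => [|j IH]; first by rewrite alt0.
have := @alt_rec R j.+1 sqf (fun=> erefl).
rewrite [decs _]/(nat_decs _) big_map /= !big_cons big1_seq ?addr0.
  rewrite subn0 subSS subn0 -[X in X + _]/(alt j.+1 sqf) -[X in _ + X]/(alt j sqf) IH.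
  by move/eqP; rewrite addr_eq0 => /eqP->; rewrite exprS mulN1r.
move=> i; rewrite mem_iota => /andP[_ /andP[i2 _]].
rewrite (@eq_alt _ _ _ (fun a => 0 * sqf a)) ?altZ ?mul0r // => a _ _.
by rewrite mul0r /sqf /= leqNgt i2.
Qed.

Lemma antip_sqf js : antip sqf js = (-1) ^+ sumn js.
Proof.
elim: js => //= j js IH.
rewrite (@eq_alt _ _ _ (fun a => antip sqf js * sqf a)) => [|a _ _]; last first.
  rewrite mulrC -antipZ; apply: eq_antip => l _ _.
  by rewrite /sqf all_cat -natrM mulnb.
by rewrite altZ alt_sqf IH mulrC exprD.
Qed.

Lemma anti_esym n : anti (esym n) = degflip (hsym n).
Proof.
apply: val_inj; apply: pserP => J /=.
rewrite (@eq_antip _ _ _ (fun l => (mdeg J == n)%:R * sqf l)) => [|l sl _]; last first.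
  by rewrite /xp /= xp_deg xp_uniq sl sumn_exps -natrM mulnb.
by rewrite antipZ antip_sqf sumn_exps mulrC.
Qed.

Lemma anti_hsym n : anti (hsym n) = degflip (esym n).
Proof.
apply: val_inj; apply: pserP => J /=.
rewrite (@eq_antip _ _ _ (fun l => (mdeg J == n)%:R * one1 l)) => [|l sl _]; last first.
  by rewrite /xp /= xp_deg sl sumn_exps mulr1.
rewrite antipZ antip_one ?exps_gt0 // (@uniq_monom J (finsupp J)) ?fset_uniq //.
have -> : all (fun a => a <= 1)%N [seq J i | i <- finsupp J] = all (pred1 1%N) [seq J i | i <- finsupp J].
  by apply: eq_in_all => a /(allP (exps_gt0 J)); case: a => [|[]].
case: ifP => [a1|_]; last by rewrite andbF !mulr0.
rewrite andbT mulrC; congr (_ ^+ _ * _); rewrite -sumn_exps.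
by have /all_pred1P -> := a1; rewrite sumn_nseq mul1n size_nseq.
Qed.

Lemma degflipK : involutive degflip.
Proof.
by move=> F; apply: val_inj; apply: pserP => J /=; rewrite mulrA -expr2 sqrr_sign mul1r.
Qed.

Lemma omega_exists : exists omega, is_omega omega.
Proof.
exists (degflip \o anti); split=> [||a F|i|n].
- split=> [|F G].
    apply: val_inj; apply: pserP => J /=.
    rewrite (@eq_antip _ _ _ (fun l => 0 * xp 0 l)) => [|l _ _]; last by rewrite mul0r.
    by rewrite antipZ mul0r mulr0.
  by rewrite /= antiD; apply: val_inj; apply: pserP => J /=; rewrite mulrDr.
- split=> [|F G] /=.
    rewrite anti1; apply: val_inj; apply: pserP => J.
    rewrite -[LHS]/(_ * (1 : pser monom R) J) coef1.
    by case: eqP => [->|]; rewrite ?mulr0 // mdeg0 mulr1.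
  rewrite antiM; apply: val_inj; apply: pserP => J.
  rewrite -[LHS]/(_ * (sser (anti F) * sser (anti G)) J) -[RHS]/((sser (degflip _) * sser (degflip _)) J).
  rewrite !coefM mulr_sumr big_seq [RHS]big_seq; apply: eq_bigr => p.
  by rewrite mem_decs => /eqP <-; rewrite /= mdegD exprD mulrACA.
- by rewrite /= antiZ; apply: val_inj; apply: pserP => J /=; rewrite mulrCA.
- by rewrite /= anti_esym anti_hsym !degflipK.
- exists n => F fF J nJ; rewrite -[LHS]/(_ * anti F J).
  by rewrite (anti_Fil fF) // mulr0.
Qed.

(* A choice of the unique map satisfying is_omega *)
Definition omega : symser R -> symser R := sval (cid omega_exists).
Definition omegat : symser R -> symser R := omega \o degflip.

Lemma omegaP : is_omega omega.
Proof. exact: svalP (cid omega_exists). Qed.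

End Omega.

Section Exponential.
Variable R : preLambdaRingType.
Implicit Types (F : symser R) (J : monom).

Lemma mdeg_mexp I k : mdeg (mexp I k) = (k * mdeg I)%N.
Proof. by elim: k => [|k IH]; rewrite ?mdeg0 // mulSn -IH -mdegD. Qed.

Lemma hop_zero (A : preLambdaRingType) k : hop k.+1 (0 : A) = 0.
Proof.
have [n] := ubnP k; elim: n k => // n IH k; rewrite ltnS => kn.
have := hopD (0 : A) 0 => /(congr1 (fun u => coef u k.+1)).
rewrite addr0 coefM [decs _]/(nat_decs _) big_map -[iota _ _]/(index_iota 0 k.+2).
rewrite big_mkord big_ord_recl big_ord_recr /= subn0 subnn hop0 mul1r mulr1 big1 ?add0r.
  by move/eqP; rewrite -subr_eq0 opprD addrA subrr sub0r oppr_eq0 => /eqP.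
move=> i _; rewrite (_ : hop _ 0 = 0) ?mul0r //; apply: (IH i).
exact: leq_trans (ltn_ord i) kn.
Qed.

Lemma hop_Fil k F : Fil 1 F -> Fil k (hop k F).
Proof.
move=> F1 J lt_Jk; rewrite -[LHS]/(hop_ser k F J) /=.
move: (mdivisors J) => D; elim: D k J lt_Jk => [|I D IH] k J lt_Jk.
  rewrite big_nil coef1 -[k == _]/(k == 0%N).
  by case: eqP lt_Jk => [->|].
rewrite big_cons coefMM big_seq big1 // => -[i j]; rewrite mem_decs /= => /eqP eij.
rewrite big_seq big1 // => -[A B]; rewrite mem_decs /= => /eqP eAB.
have [eA|] := eqVneq A (mexp I i); last by rewrite mul0r.
have [lt_A|le_A] := ltnP (mdeg A) i.
  move: lt_A; rewrite eA mdeg_mexp; case: i {eij eA} => [|i]; first by rewrite ltn0.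
  rewrite -{2}[i.+1]muln1 ltn_pmul2l // ltnS leqn0 => /eqP I0.
  by rewrite F1 ?I0 // hop_zero mul0r.
rewrite IH ?mulr0 // ltnNge; apply: contraL lt_Jk => le_B.
by rewrite -leqNgt -eAB mdegD -eij; apply: leq_add.
Qed.

Definition Exp_ser F : pser monom R :=
  PSer (fun J => \sum_(k < (mdeg J).+1) hop k F J).

Lemma Exp_sym F : Exp_ser F \in sym_pred R.
Proof.
apply/asboolP => s sb; apply: pserP => J; rewrite /= mdeg_mperm.
by apply: eq_bigr => k _; apply: (symserP (hop k F)).
Qed.

(* The sum of all hop k F for F in Fil 1: as hop k F is then in Fil k, only the
   terms with k <= mdeg J contribute to the coefficient at J, see Exp_sigma_cvg. *)
Definition Exp_sigma F : symser R := SymSer (Exp_sym F).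

Lemma sser_sum (I : Type) (s : seq I) (G : I -> symser R) :
  sser (\sum_(i <- s) G i) = \sum_(i <- s) sser (G i).
Proof. exact: (raddf_sum \val). Qed.

Lemma Exp_sigma_cvg F n m : Fil 1 F -> (n <= m)%N ->
  Fil n (Exp_sigma F - \sum_(k < m) hop k F).
Proof.
move=> F1 nm J nJ; have lt_Jm := leq_trans nJ nm.
rewrite -[LHS]/(Exp_ser F J - sser (\sum_(k < m) hop k F) J) sser_sum coef_sum /=.
rewrite -(subnKC lt_Jm) big_split_ord /= [X in _ - (_ + X)]big1 ?addr0 ?subrr // => k _.
by apply: hop_Fil => //=; rewrite addSn ltnS leq_addr.
Qed.

End Exponential.

Definition torsion_free (V : nmodType) : Prop :=
  forall (n : nat) (v : V), v *+ n.+1 = 0 -> v = 0.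

(* Main.v *)
Require Import Defs.
From mathcomp Require Import all_boot all_order all_algebra.
From HB Require Import structures.
From mathcomp Require Import finmap multiset boolp ring zify.

Set Implicit Arguments.
Unset Strict Implicit.
Unset Printing Implicit Defensive.

(* After poly, so that coefD, coefM, ... are the lemmas on power series. *)
Import Defs GRing.Theory.
Local Open Scope ring_scope.

(** In a pre-lambda ring the logarithmic derivative of sigma_t(r) is the
    generating series of the Adams operations psi_n(r). As sigma_t turns sums
    into products, each psi_n is additive (adamsD), and Newton's formula
      k h_k(r) = sum_(i + j = k) psi_i(r) h_j(r)                 (newton)
    shows that, when the target is torsion-free, a ring homomorphism commuting
    with all psi_n is a map of pre-lambda rings (hop_map). So it is enough to
    prove that omegat commutes with the psi_n, which are much simpler than the
    h_k: they act on symmetric series by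
      psi_n (sum_I r_I t^I) = sum_I psi_n(r_I) t^(nI)     (adams_ser_mexp),
    so that psi_n (F p_m) = psi_n(F) p_(nm) for the power sums p_m
    (adams_mul_psum).

    On the other side, Newton's identities for the h_n and the e_n give
    omega p_n = (-1)^(n-1) p_n, hence omegat p_n = - p_n (omegat_psum). From
    this, if omegat and psi_n commute on F, then they commute on F p_m, both
    composites having the value - psi_n(omegat F) p_(nm); and they commute on
    constants. So they commute on R-linear combinations of products of power
    sums. These are dense up to torsion: every symmetric series has a positive
    multiple which is such a combination up to terms of high degree (psum_dense).
    As omegat and psi_n are continuous and R is torsion-free, they commute
    everywhere.

    The sigma-exponential is the limit of the partial sums of the h_k, so the
    formula for it follows by continuity, once it is known that omegat preserves
    constant terms (omegat_coef0). *)

(** * The Euler derivation t d/dt on power series *)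

Section EulerDerivation.
Variable A : comPzRingType.
Implicit Types u v : pser nat A.

Definition euler u : pser nat A := PSer (fun n => u n *+ n).

Lemma eulerM u v : euler (u * v) = euler u * v + u * euler v.
Proof.
apply: pserP => n; rewrite coefD !coefM /= -sumrMnl -big_split /=.
rewrite big_seq [RHS]big_seq; apply: eq_bigr => p.
rewrite mem_decs => /eqP <-.
by rewrite mulrnDr mulrnAl mulrnAr.
Qed.

Lemma euler1 : euler 1 = 0.
Proof. by apply: pserP => -[|n]; rewrite /= ?mul0rn ?mulr0n. Qed.

(** The logarithmic derivative of a product is the sum of the logarithmic
    derivatives; stated without division. *)
Lemma euler_prod (I : eqType) (s : seq I) (F G : I -> pser nat A) :
  (forall i, euler (F i) = G i * F i) ->
  euler (\prod_(i <- s) F i) = (\sum_(i <- s) G i) * \prod_(i <- s) F i.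
Proof.
move=> FG; elim: s => [|i s IH]; first by rewrite !big_nil mul0r euler1.
rewrite !big_cons eulerM FG IH; ring.
Qed.

End EulerDerivation.

(** * Adams operations of a pre-lambda ring *)

Section Adams.
Variable A : preLambdaRingType.
Implicit Types (r s : A) (n k : nat).

(** The logarithmic derivative of sigma_t(r): by sigmaN, sigma_t(-r) is the
    inverse of sigma_t(r). *)
Definition adams_t r : pser nat A :=
  euler (sigma_t hop r) * sigma_t hop (- r).
Definition adams n r : A := adams_t r n.

Lemma sigma0 : sigma_t hop (0 : A) = 1.
Proof. by apply: pserP => -[|k]; rewrite /= ?hop0 ?hop_zero. Qed.

Lemma sigmaN r : sigma_t hop r * sigma_t hop (- r) = 1.
Proof. by rewrite -hopD subrr sigma0. Qed.

(** Since sigma_t(r) is invertible, Newton's formula characterises the Adams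
    operations. *)
Lemma adams_tE r (u : pser nat A) :
  euler (sigma_t hop r) = u * sigma_t hop r -> u = adams_t r.
Proof. by move=> e; rewrite /adams_t e -mulrA sigmaN mulr1. Qed.

Lemma euler_sigma r : euler (sigma_t hop r) = adams_t r * sigma_t hop r.
Proof. by rewrite /adams_t -mulrA (mulrC (sigma_t _ (- r))) sigmaN mulr1. Qed.

Lemma adams_tD r s : adams_t (r + s) = adams_t r + adams_t s.
Proof.
symmetry; apply: adams_tE; rewrite hopD eulerM !euler_sigma; ring.
Qed.

Lemma adamsD n : {morph adams n : r s / r + s}.
Proof. by move=> r s; rewrite /adams adams_tD. Qed.

Lemma adams0 n : adams n 0 = 0.
Proof. by apply: (addIr (adams n 0)); rewrite -adamsD !add0r. Qed.

Lemma adams_at0 r : adams 0 r = 0.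
Proof. by rewrite /adams coefM big_seq1 mul0r. Qed.

Lemma adams_sum n (I : Type) (s : seq I) (P : pred I) (F : I -> A) :
  adams n (\sum_(i <- s | P i) F i) = \sum_(i <- s | P i) adams n (F i).
Proof. exact: (big_morph _ (adamsD n) (adams0 n)). Qed.

Lemma adamsN n r : adams n (- r) = - adams n r.
Proof. by apply: (addIr (adams n r)); rewrite -adamsD !addNr adams0. Qed.

Lemma adamsMn n r k : adams n (r *+ k) = adams n r *+ k.
Proof. by elim: k => [|k IH]; rewrite ?adams0 // !mulrS adamsD IH. Qed.

Lemma newton r k :
  hop k r *+ k = \sum_(p <- decs k) adams p.1 r * hop p.2 r.
Proof. by have /(congr1 (fun u => coef u k)) := euler_sigma r; rewrite coefM. Qed.

End Adams.

Section AdamsMap.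
Variables (A B : preLambdaRingType) (phi : A -> B).
Hypotheses (phiD : GRing.nmod_morphism phi) (phiM : GRing.monoid_morphism phi).

HB.instance Definition _ := GRing.isNmodMorphism.Build A B phi phiD.
HB.instance Definition _ := GRing.isMonoidMorphism.Build A B phi phiM.

Lemma adams_map : (forall k r, phi (hop k r) = hop k (phi r)) ->
  forall n r, phi (adams n r) = adams n (phi r).
Proof.
move=> phih n r; rewrite /adams !coefM rmorph_sum.
by apply: eq_bigr => p _; rewrite rmorphM /= rmorphMn /= !phih rmorphN.
Qed.

(** Newton's formula determines k h_k from the Adams operations and the h_j with
    j < k, so h_k is determined as well where division by k is unique. *)
Lemma hop_map : torsion_free B -> (forall n r, phi (adams n r) = adams n (phi r)) ->
  forall k r, phi (hop k r) = hop k (phi r).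
Proof.
move=> tfB phia k r; have [m] := ubnP k; elim: m k => // m IH [_|k].
  by rewrite !hop0 rmorph1.
rewrite ltnS => km; apply/eqP; rewrite -subr_eq0; apply/eqP/(tfB k).
rewrite mulrnBl -rmorphMn /= !newton rmorph_sum /= -sumrB big_seq big1 // => -[i j].
rewrite mem_decs /= => /eqP eij; rewrite rmorphM /= phia.
have [->|i0] := posnP i.
  by rewrite !adams_at0 !mul0r subrr.
by rewrite IH ?subrr //; move: eij; rewrite /madd /=; lia.
Qed.

End AdamsMap.

(** * Adams operations on power series *)

Lemma coefMn (M : fdMonoidType) (R : comPzRingType) (f : pser M R) n m :
  (f *+ n) m = f m *+ n.
Proof. by elim: n => [|n IH]; rewrite ?mulr0n // !mulrS coefD IH. Qed.

Section SeriesPreLambda.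
Variable R : preLambdaRingType.

Lemma hop_ser_sigmaD (f g : pser monom R) :
  sigma_t (@hop_ser R) (f + g) = sigma_t (@hop_ser R) f * sigma_t (@hop_ser R) g.
Proof. by apply: pserP => k; rewrite coefM; apply: hop_serD. Qed.

(* The operations on symmetric series are restricted from all power series;
   there, coefficients can be computed without carrying symmetry along. *)
HB.instance Definition _ := isPreLambda.Build (pser monom R)
  (@hop_ser0 R) (@hop_ser1 R) hop_ser_sigmaD.

Lemma sser_adams n (F : symser R) : sser (adams n F) = adams n (sser F).
Proof.
apply: (@adams_map (symser R) (pser monom R) (@sser R)) => //; split=> //.
Qed.

Implicit Types (f : pser monom R) (I J K : monom).

Lemma mexpE I n i : mexp I n i = (n * I i)%N.
Proof. by elim: n => [|n IH]; rewrite ?mset0E // msetE2 IH mulSn. Qed.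

Lemma mexpDr I m n : mexp I (m + n) = madd (mexp I m) (mexp I n).
Proof. by apply/msetP => i; rewrite msetE2 !mexpE mulnDl. Qed.

Lemma mexp_inj n : (0 < n)%N -> injective (mexp^~ n).
Proof.
move=> n0 I J e; apply/msetP => i; apply/eqP; rewrite -(eqn_pmul2l n0).
by rewrite -!mexpE e.
Qed.

(** The substitution t := t t^I, which maps sigma_t(r) to sigma_at I r *)
Definition power_subst I (u : pser nat R) : pser nat (pser monom R) :=
  PSer (fun k => PSer (fun J => if J == mexp I k then u k else 0)).

Lemma power_substM I (u v : pser nat R) :
  power_subst I (u * v) = power_subst I u * power_subst I v.
Proof.
apply: pserP => n; apply: pserP => J; rewrite coefMM [LHS]/= .
have [->|nJ] := eqVneq J (mexp I n).
  rewrite big_seq [RHS]big_seq; apply: eq_bigr => -[i j].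
  rewrite mem_decs => /eqP /= en.
  have pin : (mexp I i, mexp I j) \in decs (mexp I n).
    by rewrite mem_decs /= -mexpDr -en.
  rewrite (bigD1_seq _ pin (decs_uniq _)) /= !eqxx big1 ?addr0 // => -[a b] /= ne.
  case: eqP => ea; rewrite ?mul0r //; case: eqP => eb; rewrite ?mulr0 //.
  by rewrite ea eb eqxx in ne.
rewrite big_seq big1 // => -[i j]; rewrite mem_decs /= => /eqP en.
rewrite big_seq big1 // => -[a b]; rewrite mem_decs /= => /eqP eJ.
case: eqP => ea; rewrite ?mul0r //; case: eqP => eb; rewrite ?mulr0 //.
by rewrite -eJ ea eb -mexpDr -en eqxx in nJ.
Qed.

Lemma euler_sigma_at I r :
  euler (sigma_at I r) = power_subst I (adams_t r) * sigma_at I r.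
Proof.
rewrite -[sigma_at I r]/(power_subst I (sigma_t hop r)) -power_substM -euler_sigma.
apply: pserP => n; apply: pserP => J /=.
by rewrite coefMn /=; case: eqP => // _; rewrite mul0rn.
Qed.

(** At most one divisor I of J contributes when n > 0; the sum avoids the choice
    of an n-th root of J. *)
Definition adams_ser n f : pser monom R :=
  PSer (fun J => \sum_(I <- mdivisors J) if J == mexp I n then adams n (f I) else 0).

(** sigma_t(f) is the product of the series sigma_at I (f I), whose logarithmic
    derivatives are known by substitution, so the sum of these is the logarithmic
    derivative of sigma_t(f). The product is infinite, but to compare coefficients
    at J it can be restricted to the divisors of J. *)
Lemma adams_serE n f : adams n f = adams_ser n f.
Proof.
suff e : PSer (fun k => adams_ser k f) = adams_t f by rewrite /adams -e.
apply: adams_tE; apply: pserP => k; apply: pserP => J.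
pose U := \prod_(I <- mdivisors J) sigma_at I (f I).
pose Phi := \sum_(I <- mdivisors J) power_subst I (adams_t (f I)).
have -> : euler (sigma_t hop f) k J = euler U k J by rewrite /= !coefMn.
rewrite (euler_prod _ (fun I => euler_sigma_at I (f I))).
rewrite -/U -/Phi [LHS]coefMM [RHS]coefMM. apply: eq_bigr => -[i j] _.
rewrite big_seq [RHS]big_seq; apply: eq_bigr => -[A B] /mdivisors_decs[/= dA dB].
congr (_ * _); last first.
  apply: hop_ser_stable; first exact: undup_uniq.
  by move=> C dC; apply: mdivisors_trans dC dB.
rewrite !coef_sum /= [LHS](bigID (fun I => I \in mdivisors A)) /= [X in _ + X]big1 ?addr0.
  rewrite -big_filter; apply: perm_big; apply: uniq_perm; rewrite ?filter_uniq ?undup_uniq // => I.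
  by rewrite mem_filter; apply/andP/idP => [[]|dI] //; split=> //; apply: mdivisors_trans dA.
(* For i = 0 the exponent I need not divide A, but the operation is zero. *)
move=> I; case: eqP => // -> /negP nI; case: i nI {dA} => [|i] nI; first exact: adams_at0.
by case: nI; apply/mem_mdivisors; exists (mexp I i).
Qed.

Lemma adams_ser_mexp n f I : (0 < n)%N -> adams n f (mexp I n) = adams n (f I).
Proof.
move=> n0; rewrite adams_serE /= (bigD1_seq I) ?undup_uniq //=.
  rewrite eqxx big1 ?addr0 // => K nK; case: eqP => // /(mexp_inj n0) e.
  by rewrite e eqxx in nK.
by case: n n0 => // n _; apply/mem_mdivisors; exists (mexp I n).
Qed.

Lemma adams_ser_nmexp n f J : (forall I, J <> mexp I n) -> adams n f J = 0.
Proof.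
by move=> nJ; rewrite adams_serE /= big1 // => I _; case: eqP => // /nJ.
Qed.

Lemma adams_Fil n m (F : symser R) : Fil m F -> Fil m (adams n F).
Proof.
move=> fF J lt_J; rewrite sser_adams; case: (posnP n) => [->|n0]; first by rewrite adams_at0.
have [[I eJ]|nJ] := pselect (exists I, J = mexp I n); last first.
  by apply: adams_ser_nmexp => I eJ; apply: nJ; exists I.
rewrite eJ adams_ser_mexp // fF ?adams0 //; apply: leq_ltn_trans lt_J.
by rewrite eJ mdeg_mexp leq_pmull.
Qed.

End SeriesPreLambda.

(** * Power sums *)

(** The quotient of J by the n-th power of the i-th variable; a genuine quotient
    only if n <= J i, see mremK. *)
Definition mrem (J : monom) n i : monom := msetB J (msetn n i).

Lemma mremE (J : monom) n i j : mrem J n i j = (J j - (if j == i then n else 0))%N.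
Proof. by rewrite /mrem msetE2 msetnE. Qed.

Lemma mremK (J : monom) n i : (n <= J i)%N -> madd (mrem J n i) (msetn n i) = J.
Proof.
move=> le; apply/msetP => j; rewrite msetE2 mremE msetnE.
by case: eqP => [->|_]; rewrite ?subnK ?subn0 ?addn0.
Qed.

Section PowerSums.
Local Open Scope mset_scope.
Variable R : comPzRingType.
Implicit Types (f : pser monom R) (F G : symser R) (I J K : monom).

Lemma mperm_msetn s n i : mperm s (msetn n i) = msetn n (s i).
Proof. by rewrite /mperm enum_msetn map_nseq -(enum_msetn n (s i)) seq_mset_id. Qed.

(** For n = 0 this is zero, not the infinite sum of 1's, so that Newton's
    identities can be written as convolutions over all of decs n. *)
Definition psum_ser n : pser monom R :=
  PSer (fun J => `[< (0 < n)%N /\ exists i, J = msetn n i >]%:R).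

Lemma psum_sym n : psum_ser n \in sym_pred R.
Proof.
apply/asboolP => s [s' sK s'K]; apply: pserP => J /=; congr (nat_of_bool _)%:R.
apply: asbool_equiv_eq; split=> -[n0 [i e]]; split=> //; last first.
  by exists (s i); rewrite e mperm_msetn.
by exists (s' i); rewrite -mperm_msetn -e mpermK.
Qed.

Definition psum n : symser R := SymSer (psum_sym n).

Lemma psum0 : psum 0 = 0.
Proof.
by apply: val_inj; apply: pserP => J /=; rewrite (_ : `[< _ >] = false) //; apply/asboolP => -[].
Qed.

Lemma coef_mul_psum f n J : (0 < n)%N ->
  (f * psum_ser n) J = \sum_(i <- finsupp J | (n <= J i)%N) f (mrem J n i).
Proof.
move=> n0; rewrite coefM /=.
rewrite (eq_bigr (fun p : monom * monom =>
  if `[< exists i, p.2 = msetn n i >] then f p.1 else 0)) => [|p _]; last first.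
  rewrite (_ : `[< _ /\ _ >] = `[< exists i, p.2 = msetn n i >]); last first.
    by apply: asbool_equiv_eq; split=> [[]|].
  by case: asboolP => _; rewrite ?mulr1 ?mulr0.
rewrite -big_mkcond -big_filter -[RHS]big_filter.
rewrite -[RHS](big_map (fun i => (mrem J n i, msetn n i)) xpredT (fun p => f p.1)).
apply: perm_big; apply: uniq_perm; rewrite ?filter_uniq ?decs_uniq //.
  rewrite map_inj_uniq ?filter_uniq ?fset_uniq // => i j [_].
  by move/(msetn_inj n0).
case=> A B; rewrite mem_filter mem_decs; apply/andP/mapP => /=.
  case=> /asboolP[i ->] /eqP <-; exists i; last by rewrite /mrem /madd /= msetDKBC.
  by rewrite mem_filter mem_finsupp !msetE2 msetnxx leq_addl -lt0n addn_gt0 n0 orbT.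
case=> i; rewrite mem_filter => /andP[le _] [-> ->]; split.
  by apply/asboolP; exists i.
by rewrite mremK.
Qed.

End PowerSums.

(** * Newton's identities for the complete and elementary functions *)

Section Newton.
Local Open Scope mset_scope.
Variable R : comPzRingType.
Implicit Types (F G : symser R) (J K : monom).

Lemma mdegB J n i : (n <= J i)%N -> mdeg (mrem J n i) = (mdeg J - n)%N.
Proof.
move=> le; have {2}<- := mremK le.
by rewrite mdegD /(mdeg (msetn _ _)) enum_msetn size_nseq addnK.
Qed.

Lemma leq_mdeg J i : (J i <= mdeg J)%N.
Proof. by rewrite -count_mem_mset count_size. Qed.

Lemma decs_nat (V : nmodType) n (F : nat -> nat -> V) :
  \sum_(p <- decs n) F p.1 p.2 = F 0%N n + \sum_(k < n) F k.+1 (n - k.+1)%N.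
Proof.
rewrite [decs n]/(nat_decs n) big_map -[iota 0 n.+1]/(index_iota 0 n.+1) big_mkord.
by rewrite big_ord_recl subn0.
Qed.

(** Both identities are instances: if the series g_m is homogeneous of degree m
    with coefficients c(K), then the convolution of p_k, weighted by w(k), with
    g_m is homogeneous of degree n, and its coefficient at J runs over the ways
    to take a power of one variable out of J. *)
Lemma newton_coef (w : nat -> R) (c : monom -> R) n J :
  (\sum_(p <- decs n) w p.1 *:
    (PSer (fun K => (mdeg K == p.2)%:R * c K) * psum_ser R p.1)) J =
  (mdeg J == n)%:R *
    \sum_(i <- finsupp J) \sum_(k < J i) w k.+1 * c (mrem J k.+1 i).
Proof.
pose g m : pser monom R := PSer (fun K => (mdeg K == m)%:R * c K).
rewrite coef_sum (decs_nat n (fun k m => (w k *: (g m * psum_ser R k)) J)).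
rewrite coefZ -[psum_ser R 0]/(sser (psum R 0)) psum0 !mulr0 add0r.
rewrite (eq_bigr (fun k : 'I_n => \sum_(i <- finsupp J) (mdeg J == n)%:R *
    (if (k < J i)%N then w k.+1 * c (mrem J k.+1 i) else 0))).
  rewrite exchange_big mulr_sumr; apply: eq_bigr => i _.
  rewrite -mulr_sumr; have [Jn|_] := eqVneq (mdeg J) n; last by rewrite !mul0r.
  congr (_ * _); rewrite -big_mkcond -(big_ord_widen _ (fun k => w k.+1 * c (mrem J k.+1 i))) //.
  by rewrite -Jn leq_mdeg.
move=> k _; rewrite coefZ coef_mul_psum // mulr_sumr big_mkcond; apply: eq_bigr => i _.
case: ifP => [le|_]; last by rewrite mulr0.
rewrite /= mdegB // mulrCA; congr (_%:R * _).
have le_k := leq_trans le (leq_mdeg J i); congr (nat_of_bool _).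
by apply/eqP/eqP; have := ltn_ord k; lia.
Qed.

Lemma uniq_monP J : reflect (forall j, J j <= 1)%N (uniq J).
Proof.
apply: (iffP idP) => [uJ j|le1]; first by rewrite -count_mem_mset count_uniq_mem // leq_b1.
by apply: count_mem_uniq => j; rewrite count_mem_mset in_mset; case: (J j) (le1 j) => [|[]].
Qed.

Lemma symser_sumE (I : Type) (s : seq I) (H : I -> symser R) J :
  (\sum_(i <- s) H i) J = \sum_(i <- s) H i J.
Proof. by elim/big_rec2: _ => //= i x y _ <-. Qed.

Lemma symser_MnE F n J : (F *+ n) J = F J *+ n.
Proof. by elim: n => [|n IH]; rewrite ?mulr0n // !mulrS -IH. Qed.

Lemma newton_hsym n : hsym R n *+ n = \sum_(p <- decs n) psum R p.1 * hsym R p.2.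
Proof.
apply: val_inj; apply: pserP => J; rewrite symser_MnE symser_sumE.
have := newton_coef (fun=> 1) (fun=> 1) n J; rewrite coef_sum.
rewrite (eq_bigr (fun p : nat * nat => (psum R p.1 * hsym R p.2) J)) => [->|p _]; last first.
  rewrite coefZ mul1r mulrC; congr (coef (_ * _) _).
  by apply: pserP => K /=; rewrite mulr1.
rewrite (eq_bigr (fun i => (J i)%:R)) => [|i _]; last first.
  by under eq_bigr do rewrite mulr1; rewrite sumr_const card_ord.
rewrite -natr_sum -size_mset -[size _]/(mdeg J) /=.
by case: eqP => [->|_]; rewrite ?mul0rn ?mul0r ?mul1r.
Qed.

(** If J i = 1, the sum is its only term; if J i > 1, only the last two terms can
    be nonzero, when the exponent left is 1 or 0, and they cancel. *)
Lemma uniq_mrem J i : i \in finsupp J ->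
  \sum_(k < J i) (-1) ^+ k.+2 * (uniq (mrem J k.+1 i))%:R = (uniq J)%:R :> R.
Proof.
rewrite mem_finsupp => Ji.
have uE k : (0 < k)%N -> (k <= J i)%N -> uniq (mrem J k i) =
    (J i <= k.+1)%N && uniq (mrem J (J i) i).
  move=> k0 kJ; apply/uniq_monP/andP => [u|[le1 /uniq_monP u] j].
    split; first by have := u i; rewrite mremE eqxx; lia.
    by apply/uniq_monP => j; have := u j; rewrite !mremE; case: eqP => [->|]; lia.
  by have := u j; rewrite !mremE; case: eqP => [->|]; lia.
have uJ : uniq J = (J i <= 1)%N && uniq (mrem J (J i) i).
  apply/uniq_monP/andP => [u|[le1 /uniq_monP u] j].
    split; first exact: u.
    by apply/uniq_monP => j; have := u j; rewrite mremE; lia.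
  by have := u j; rewrite mremE; case: eqP => [->|]; lia.
under eq_bigr => k _ do rewrite uE //.
rewrite uJ; case: (J i) Ji => // -[|a] _; first by rewrite big_ord1 !exprS expr0; ring.
rewrite !big_ord_recr big1 /= => [|k _]; last by rewrite ltnNge ltnS ltn_ord /= mulr0.
rewrite !leqnn leqnSn /= !exprS; ring.
Qed.

Lemma symser_scaleAl (a : R) F G : (a *: F) * G = a *: (F * G).
Proof.
apply: val_inj; apply: pserP => J.
rewrite -[LHS]/((a *: sser F * sser G) J) -[RHS]/(a * (sser F * sser G) J) !coefM mulr_sumr.
by apply: eq_bigr => p _; rewrite coefZ mulrA.
Qed.

Lemma newton_esym n : esym R n *+ n =
  \sum_(p <- decs n) ((-1) ^+ p.1.+1 *: psum R p.1) * esym R p.2.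
Proof.
apply: val_inj; apply: pserP => J; rewrite symser_MnE symser_sumE; move: (J : monom) => {}J.
have := newton_coef (fun k => (-1) ^+ k.+1) (fun K => (uniq K)%:R) n J; rewrite coef_sum.
rewrite (eq_bigr (fun p : nat * nat => (((-1) ^+ p.1.+1 *: psum R p.1) * esym R p.2) J)) => [->|p _]; last first.
  rewrite symser_scaleAl mulrC !coefZ; congr (_ * coef (_ * _) _).
  by apply: pserP => K /=; rewrite -natrM mulnb.
rewrite (eq_big_seq (fun=> (uniq J)%:R)) => [|i iJ]; last exact: uniq_mrem.
rewrite big_const_seq count_predT iter_addr_0 /=.
have [uJ|] := boolP (uniq J); last by rewrite andbF mul0rn mul0rn mulr0.
rewrite andbT; case: eqP => [<-|_]; rewrite ?mul0r ?mul0rn // mul1r /mdeg.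
rewrite -(perm_size (perm_undup_mset J)) undup_id //.
Qed.

End Newton.

(** * The involution on power sums *)

Section OmegaPowerSums.
Variable R : comPzRingType.
Implicit Types F G : symser R.

(** omega exchanges the left sides of the two Newton identities; comparing the
    right sides, all terms agree by induction but the one with p_n h_0, resp.
    p_n e_0. *)
Lemma omega_psum n : (0 < n)%N -> omega (psum R n) = (-1) ^+ n.+1 *: psum R n.
Proof.
have [[o0 oD] [o1 oM] oZ oeh _] := omegaP R.
have oMn F k : omega (F *+ k) = omega F *+ k.
  by elim: k => [|k IH]; rewrite ?mulr0n // !mulrS oD IH.
have osum := big_morph _ oD o0.
have [m] := ubnP n; elim: m n => // m IH n; rewrite ltnS => nm n0.
have := congr1 (@omega R) (newton_hsym R n).
rewrite oMn (oeh n).2 newton_esym osum => /eqP; rewrite eq_sym -subr_eq0 -sumrB.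
have dn : (n, 0%N) \in decs n by rewrite mem_decs /madd /= addn0.
rewrite (bigD1_seq _ dn (decs_uniq _)) /= big_seq_cond big1 ?addr0 => [|[i j]].
  have e0 : esym R 0 = 1.
    apply: val_inj; apply: pserP => J; rewrite /= -mdeg_eq0.
    by case: eqP => //= /eqP; rewrite mdeg_eq0 => /eqP ->; rewrite enum_mset0.
  by rewrite oM (oeh 0%N).2 e0 !mulr1 subr_eq0 => /eqP.
rewrite mem_decs => /andP[/eqP /= eij ne]; rewrite oM (oeh j).2.
have [->|i0] := posnP i; first by rewrite psum0 o0 scaler0 subrr.
have jn : j != 0%N by apply: contraNneq ne => j0; rewrite j0 -eij /madd /= j0 addn0.
by rewrite IH ?subrr //; move: eij nm jn; rewrite /madd /=; lia.
Qed.

Lemma degflip_psum n : degflip (psum R n) = (-1) ^+ n *: psum R n.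
Proof.
apply: val_inj; apply: pserP => J /=; case: asboolP => [[n0 [i ->]]|_]; last by rewrite !mulr0.
by rewrite /mdeg enum_msetn size_nseq.
Qed.

Lemma omegatD : GRing.nmod_morphism (@omegat R).
Proof.
have [[o0 oD] _ _ _ _] := omegaP R; split=> [|F G]; rewrite /omegat /=.
  rewrite (_ : degflip 0 = 0) ?o0 //.
  by apply: val_inj; apply: pserP => J /=; rewrite mulr0.
by rewrite -oD; congr omega; apply: val_inj; apply: pserP => J /=; rewrite mulrDr.
Qed.

Lemma omegatM : GRing.monoid_morphism (@omegat R).
Proof.
have [_ [o1 oM] _ _ _] := omegaP R; split=> [|F G]; rewrite /omegat /=.
  rewrite -[RHS]o1; congr omega; apply: val_inj; apply: pserP => J.
  rewrite -[LHS]/(_ * (1 : pser monom R) J) coef1 -mdeg_eq0.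
  by case: eqP => [->|]; rewrite ?mulr0 ?mulr1.
rewrite -oM; congr omega; apply: val_inj; apply: pserP => J.
rewrite -[LHS]/(_ * (sser F * sser G) J).
rewrite -[RHS]/((sser (degflip F) * sser (degflip G)) J).
rewrite !coefM mulr_sumr big_seq [RHS]big_seq; apply: eq_bigr => p.
by rewrite mem_decs => /eqP <-; rewrite /= mdegD exprD mulrACA.
Qed.

HB.instance Definition _ := GRing.isNmodMorphism.Build _ _ (@omegat R) omegatD.
HB.instance Definition _ := GRing.isMonoidMorphism.Build _ _ (@omegat R) omegatM.

Lemma omegatZ a F : omegat (a *: F) = a *: omegat F.
Proof.
have [_ _ oZ _ _] := omegaP R; rewrite /omegat /= -oZ; congr omega.
by apply: val_inj; apply: pserP => J /=; rewrite mulrCA.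
Qed.

Lemma omegat_psum n : (0 < n)%N -> omegat (psum R n) = - psum R n.
Proof.
have [_ _ oZ _ _] := omegaP R.
move=> n0; rewrite /omegat /= degflip_psum oZ omega_psum // scalerA -exprD.
by rewrite addnS exprS -signr_odd addnn odd_double mulr1 scaleN1r.
Qed.

Lemma omegat_continuous n : exists m, forall F, Fil m F -> Fil n (omegat F).
Proof.
have [_ _ _ _ /(_ n)[m oF]] := omegaP R; exists m => F fF; apply: oF => J lt_J /=.
by rewrite fF // mulr0.
Qed.

End OmegaPowerSums.

(** * Density of the polynomials in the power sums, up to torsion *)

Section Density.
Variable R : comPzRingType.
Implicit Types (F G : symser R) (J : monom).

(** Used to see that a coefficient of a symmetric series depends only on the
    exponents of the monomial. *)
Lemma bij_extend (r r' : seq nat) : uniq r -> uniq r' -> size r = size r' ->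
  exists2 s : nat -> nat, bijective s & map s r = r'.
Proof.
elim: r r' => [|x r IH] [|y r'] //=; first by exists id => //; exists id.
move=> /andP[xr ur] /andP[yr' ur'] [sz]; have [s sb sr] := IH _ ur ur' sz.
pose t i := if i == s x then y else if i == y then s x else i.
have tK : involutive t.
  move=> i; rewrite /t; have [->|n1] := eqVneq i (s x).
    by rewrite eqxx; case: eqP.
  by have [->|n2] := eqVneq i y; rewrite ?eqxx // (negPf n1) (negPf n2).
exists (t \o s); first exact: bij_comp (inv_bij tK) sb.
rewrite /= {1}/t eqxx -sr map_comp sr; congr (_ :: _).
rewrite -[RHS]map_id; apply/eq_in_map => i ir'; rewrite /t.
case: eqP => [ei|_]; last by case: eqP => // ei; rewrite -ei ir' in yr'.
by move: ir' xr; rewrite ei -sr (mem_map (bij_inj sb)) => ->.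
Qed.

Lemma mperm_mon_at s r p : mperm s (mon_at r p) = mon_at (map s r) p.
Proof.
elim: r p => [|i r IH] [|a p] //=; try exact: mperm0.
by rewrite -[LHS]/(mperm s (madd _ _)) mpermD IH mperm_msetn.
Qed.

Definition coef_exps F (l : seq nat) : R := F (mon_at (iota 0 (size l)) l).

Lemma coef_exps_finsupp F J : coef_exps F [seq J i | i <- finsupp J] = F J.
Proof.
rewrite /coef_exps size_map.
have sz : size (finsupp J) = size (iota 0 (size (finsupp J))) by rewrite size_iota.
have [s sb <-] := bij_extend (fset_uniq _) (iota_uniq _ _) sz.
by rewrite -mperm_mon_at mon_at_map ?fset_uniq // symserP.
Qed.

(** The sum of c(b_1, ..., b_l) p_(b_1) ... p_(b_l) over all l-tuples with
    entries between 1 and m *)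
Fixpoint psums m l (c : seq nat -> R) : symser R :=
  if l is l'.+1 then \sum_(b <- iota 1 m) psums m l' (fun a => c (b :: a)) * psum R b
  else c [::] *: (1 : symser R).

Lemma finsupp_mrem_lt J b i : (b < J i)%N -> finsupp (mrem J b i) = finsupp J.
Proof.
move=> lt; apply/fsetP => j; rewrite !mem_finsupp mremE.
by have [->|_] := eqVneq j i; rewrite ?subn0 //; lia.
Qed.

Lemma finsupp_mrem J i : finsupp (mrem J (J i) i) = (finsupp J `\ i)%fset.
Proof.
apply/fsetP => j; rewrite in_fsetD1 !mem_finsupp mremE.
by have [->|_] := eqVneq j i; rewrite ?subn0 ?subnn.
Qed.

Lemma symser_coef_mul_psum F n J : (0 < n)%N ->
  (F * psum R n) J = \sum_(i <- finsupp J | (n <= J i)%N) F (mrem J n i).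
Proof. exact: coef_mul_psum. Qed.

(** A product of l power sums only has monomials in at most l variables: a factor
    p_b removes at most one variable from the support. *)
Lemma psums_long m l c J : (l < #|` finsupp J|)%N -> psums m l c J = 0.
Proof.
elim: l c J => [|l IH] c J lt_l /=.
  rewrite -[LHS]/(_ * (1 : pser monom R) J) coef1.
  case: eqP => [eJ|]; last by rewrite mulr0.
  by move: lt_l; rewrite eJ finsupp0.
rewrite symser_sumE big1_seq // => b; rewrite mem_iota => /andP[_ /andP[b0 _]].
rewrite symser_coef_mul_psum // big1_seq // => i /andP[le iJ]; apply: IH.
move: le; rewrite leq_eqVlt => /orP[/eqP ->|lt]; last by rewrite finsupp_mrem_lt // ltnW.
by rewrite finsupp_mrem; move: lt_l; rewrite (cardfsD1 i) iJ.
Qed.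

(** On a monomial in exactly l variables each factor must use up one variable
    with its full exponent. So the tuples (b_1, ..., b_l) that contribute are the
    orderings of the exponents of J, one for each of the l! orderings of the
    variables; the inductive step chooses the variable that b_1 uses up. *)
Lemma psums_coef m l c J :
  (forall a a', perm_eq a a' -> c a = c a') ->
  #|` finsupp J| = l -> (mdeg J <= m)%N ->
  psums m l c J = c [seq J i | i <- finsupp J] *+ l`!.
Proof.
elim: l c J => [|l IH] c J cP lJ mJ /=.
  have -> : J = mzero.
    by apply/msetP => j; rewrite mset0E; apply/eqP; rewrite -memNfinsupp (cardfs0_eq lJ).
  by rewrite finsupp0 -[LHS]/(_ * (1 : pser monom R) mzero) coef1 eqxx mulr1.
rewrite symser_sumE.
rewrite (eq_big_seq (fun b => \sum_(i <- finsupp J)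
    if b == J i then c [seq J i | i <- finsupp J] *+ l`! else 0)).
  rewrite exchange_big (eq_big_seq (fun=> c [seq J i | i <- finsupp J] *+ l`!)).
    by rewrite big_const_seq count_predT iter_addr_0 -mulrnA factS -lJ mulnC.
  move=> i; rewrite mem_finsupp -lt0n => Ji.
  rewrite -big_mkcond -big_filter filter_pred1_uniq ?iota_uniq ?big_seq1 //.
  by rewrite mem_iota Ji add1n ltnS; apply: leq_trans (leq_mdeg J i) mJ.
move=> b; rewrite mem_iota => /andP[b0 bm].
rewrite symser_coef_mul_psum // big_mkcond; apply: eq_big_seq => i iJ.
have [lt|lt|eb] := ltngtP b (J i).
- by rewrite psums_long // finsupp_mrem_lt // lJ.
- by [].
have cJ : #|` finsupp (mrem J (J i) i)| = l.
  by rewrite finsupp_mrem; move: lJ; rewrite (cardfsD1 i) iJ => -[].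
rewrite eb IH //; first last.
- by rewrite mdegB //; apply: leq_trans mJ; apply: leq_subr.
- by move=> a a' paa'; apply: cP; rewrite perm_cons.
congr (_ *+ _); apply: cP; rewrite finsupp_mrem.
rewrite (eq_in_map (mrem J (J i) i) J (finsupp J `\ i)%fset).1 => [|j]; last first.
  by rewrite in_fsetD1 mremE => /andP[/negPf -> _]; rewrite subn0.
apply: (perm_map J (s := i :: (finsupp J `\ i)%fset)); apply: uniq_perm => [||j].
- by rewrite /= in_fsetD1 eqxx fset_uniq.
- exact: fset_uniq.
by rewrite inE in_fsetD1; have [->|] := eqVneq j i.
Qed.

(** By descending induction on the number of variables: if F has no monomial in
    more than l variables (in degrees below m), then psums with the coefficients
    of F agrees with l! F on the monomials in exactly l variables, and the
    difference has only monomials in fewer variables. Stated as an induction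
    principle, with K the property to be proved for polynomials in the p_n. *)
Lemma psum_dense (K : symser R -> Prop) :
  (forall a, K (a *: (1 : symser R))) -> (forall F G, K F -> K G -> K (F + G)) ->
  (forall F n, (0 < n)%N -> K F -> K (F * psum R n)) ->
  forall F m, exists N, exists2 P, K P & Fil m (F *+ N.+1 - P).
Proof.
move=> K1 KD Kp F m.
have K0 : K 0 by rewrite -(scale0r (1 : symser R)).
have Kpsums l c : K (psums m l c).
  elim: l c => [|l IH] c /=; first exact: K1.
  rewrite big_seq; elim/big_ind: _ => // b; rewrite mem_iota => /andP[b0 _].
  exact: Kp.
suff H l F' : (forall J, (mdeg J < m)%N -> (l <= #|` finsupp J|)%N -> F' J = 0) ->
    exists N, exists2 P, K P & Fil m (F' *+ N.+1 - P).
  apply: (H m) => J lt_J le_J; suff : (#|` finsupp J| <= mdeg J)%N by lia.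
  rewrite /mdeg size_mset -sum1_size big_seq [X in (_ <= X)%N]big_seq.
  by apply: leq_sum => i; rewrite mem_finsupp lt0n.
elim: l F' => [|l IH] {}F F0.
  by exists 0%N, 0 => // J lt_J; rewrite subr0 F0.
pose c := coef_exps F; pose Q := psums m l c.
have [J lt_J le_J|N [P KP FP]] := IH (F *+ l`! - Q).
  rewrite -[LHS]/((F *+ l`!) J - Q J) symser_MnE.
  move: le_J; rewrite leq_eqVlt => /orP[/eqP eJ|lt_l]; last first.
    by rewrite F0 // mul0rn /Q psums_long // subrr.
  rewrite /Q psums_coef // ?(ltnW lt_J) //; last by move=> a a'; apply: xp_perm.
  by rewrite /c coef_exps_finsupp subrr.
exists (l`! * N.+1).-1, (P + Q *+ N.+1).
  apply: (KD _ _ KP); elim: N.+1 => [|k IHk]; rewrite ?mulr0n // mulrS.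
  exact: (KD _ _ (Kpsums l c) IHk).
rewrite prednK ?muln_gt0 ?fact_gt0 // [P + _]addrC opprD addrA.
by rewrite mulrnA -mulrnBl.
Qed.

End Density.

(** * The involution commutes with the Adams operations *)

Section AdamsOmega.
Variable R : preLambdaRingType.
Implicit Types (F : symser R) (I J : monom).

Lemma adams_const n a : (0 < n)%N ->
  adams n (a *: (1 : symser R)) = adams n a *: (1 : symser R).
Proof.
move=> n0; apply: val_inj; apply: pserP => J /=; rewrite sser_adams.
have [[I ->]|nJ] := pselect (exists I, J = mexp I n).
  rewrite adams_ser_mexp // -[sser _ I]/(a * (1 : pser monom R) I) coef1.
  rewrite -[RHS]/(_ * (1 : pser monom R) _) coef1 -!mdeg_eq0 mdeg_mexp muln_eq0 (gtn_eqF n0) /=.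
  by case: eqP => _; rewrite ?mulr1 // !mulr0 adams0.
rewrite adams_ser_nmexp => [|I eJ]; last by apply: nJ; exists I.
rewrite -[RHS]/(_ * (1 : pser monom R) J) coef1; case: eqP => [eJ|]; last by rewrite mulr0.
by case: nJ; exists mzero; apply/msetP => i; rewrite mexpE eJ mset0E muln0.
Qed.

(** The coefficients of p_m are 0 and 1, so those of F p_m are sums of
    coefficients of F, to which additivity of the Adams operations applies. *)
Lemma adams_mul_psum n m F : (0 < n)%N -> (0 < m)%N ->
  adams n (F * psum R m) = adams n F * psum R (n * m).
Proof.
move=> n0 m0; apply: val_inj; apply: pserP => J /=; rewrite sser_adams.
have nm0 : (0 < n * m)%N by rewrite muln_gt0 n0.
rewrite -[RHS]/((adams n F * psum R (n * m)) J) symser_coef_mul_psum // sser_adams.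
have [[I ->]|nJ] := pselect (exists I, J = mexp I n); last first.
  rewrite adams_ser_nmexp => [|I eJ]; last by apply: nJ; exists I.
  rewrite big1 // => i le; apply: adams_ser_nmexp => I eJ; apply: nJ.
  exists (madd I (msetn m i)); rewrite -(mremK le) eJ; apply/msetP => j.
  by rewrite msetE2 !mexpE msetE2 !msetnE mulnDr; case: eqP; rewrite ?muln0.
rewrite adams_ser_mexp // -[sser _ I]/((F * psum R m) I) symser_coef_mul_psum // adams_sum.
have -> : finsupp (mexp I n) = finsupp I.
  by apply/fsetP => i; rewrite !mem_finsupp mexpE muln_eq0 (gtn_eqF n0).
apply: eq_big => [i|i _]; first by rewrite mexpE leq_pmul2l.
rewrite -adams_ser_mexp //; congr (coef _ _); apply/msetP => j.
by rewrite !(mexpE, mremE) mulnBr; case: eqP; rewrite ?muln0.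
Qed.

Hypothesis R_tf : torsion_free R.

Lemma symser_torsion_free : torsion_free (symser R).
Proof.
move=> n F e; apply: val_inj; apply: pserP => J; apply: (R_tf (n := n)).
by rewrite -symser_MnE e.
Qed.

(** The map D measuring the defect of commutation is additive, continuous, and
    zero on polynomials in the power sums. *)
Lemma omegat_adams n F : omegat (adams n F) = adams n (omegat F).
Proof.
have [->|n0] := posnP n; first by rewrite !adams_at0 rmorph0.
pose K (G : symser R) := omegat (adams n G) = adams n (omegat G).
have oc a : omegat (a *: (1 : symser R)) = a *: (1 : symser R).
  by rewrite omegatZ rmorph1.
have K1 a : K (a *: (1 : symser R)) by rewrite /K adams_const // !oc adams_const.
have KD G H : K G -> K H -> K (G + H).
  by rewrite /K adamsD !rmorphD /= adamsD => -> ->.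
have Kp G m : (0 < m)%N -> K G -> K (G * psum R m).
  rewrite /K => m0 e; rewrite adams_mul_psum // !rmorphM /= e.
  by rewrite !omegat_psum ?muln_gt0 ?n0 // !mulrN adamsN adams_mul_psum.
apply: val_inj; apply: pserP => J.
have [m0 oF] := @omegat_continuous R (mdeg J).+1.
have [N [P KP FP]] := psum_dense K1 KD Kp F m0.
pose G := F *+ N.+1 - P; pose D (H : symser R) := omegat (adams n H) - adams n (omegat H).
have DG : D F *+ N.+1 = D G.
  rewrite /D /G !adamsD !rmorphD /= !adamsD !adamsN !rmorphN /= !adamsN KP.
  by rewrite !adamsMn !rmorphMn /= adamsMn mulrnBl opprD opprK addrACA addNr addr0.
apply/eqP; rewrite -subr_eq0; apply/eqP/(R_tf (n := N)).
rewrite -[LHS]/(D F J *+ N.+1) -symser_MnE DG.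
rewrite -[LHS]/(omegat (adams n G) J - adams n (omegat G) J).
by rewrite (oF _ (@adams_Fil _ n _ _ FP)) // (@adams_Fil _ n _ _ (oF _ FP)) ?subrr.
Qed.

Lemma omegat_hop k F : omegat (hop k F) = hop k (omegat F).
Proof.
exact: (hop_map (@omegatD R) (@omegatM R) symser_torsion_free omegat_adams).
Qed.

(** The modulus of continuity of omegat is not specified, so this comes from
    density: omegat fixes constants and maps multiples of a power sum to such
    multiples, which have no constant term. *)
Lemma omegat_coef0 F : omegat F mzero = F mzero.
Proof.
pose K (G : symser R) := omegat G mzero = G mzero.
have K1 a : K (a *: (1 : symser R)) by rewrite /K omegatZ rmorph1.
have KD G H : K G -> K H -> K (G + H).
  by rewrite /K rmorphD => e1 e2; congr (_ + _).
have coef0_psum G m : (0 < m)%N -> (G * psum R m) mzero = 0.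
  by move=> m0; rewrite symser_coef_mul_psum // finsupp0 big_nil.
have Kp G m : (0 < m)%N -> K G -> K (G * psum R m).
  move=> m0 _; rewrite /K.
  have -> : omegat (G * psum R m) = - (omegat G * psum R m).
    by rewrite rmorphM /= omegat_psum // mulrN.
  by rewrite -[LHS]/(- _ mzero) !coef0_psum ?oppr0.
have [m0 oF] := @omegat_continuous R 1.
have [N [P KP FP]] := psum_dense K1 KD Kp F (maxn m0 1).
have d0 : mdeg mzero = 0%N by apply: mdeg0.
have e1 : (F *+ N.+1 - P) mzero = 0 by apply: FP; rewrite d0 leq_max orbT.
have e2 : (omegat (F *+ N.+1 - P)) mzero = 0.
  by apply: oF; rewrite ?d0 // => I lt_I; apply: FP; rewrite leq_max lt_I.
apply/eqP; rewrite -subr_eq0; apply/eqP/(R_tf (n := N)); rewrite mulrnBl -!symser_MnE.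
move: e1 e2; rewrite rmorphB /= rmorphMn /=.
rewrite -[X in X = 0 -> _]/(_ mzero - P mzero) -[X in _ -> X = 0 -> _]/(_ mzero - omegat P mzero).
by rewrite KP => /subr0_eq -> /subr0_eq ->; rewrite subrr.
Qed.

Lemma omegat_Exp F : Fil 1 F -> omegat (Exp_sigma F) = Exp_sigma (omegat F).
Proof.
move=> F1; have oF1 : Fil 1 (omegat F).
  move=> J; rewrite ltnS leqn0 mdeg_eq0 => /eqP ->.
  by rewrite omegat_coef0 F1 // mdeg0.
apply: val_inj; apply: pserP => J.
have [m oF] := @omegat_continuous R (mdeg J).+1.
pose M := maxn m (mdeg J).+1.
have := oF _ (Exp_sigma_cvg F1 (leq_maxl m (mdeg J).+1)) J (leqnn _).
have := Exp_sigma_cvg oF1 (leq_maxr m (mdeg J).+1) (leqnn _).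
have -> : omegat (Exp_sigma F - \sum_(k < M) hop k F) =
    omegat (Exp_sigma F) - \sum_(k < M) hop k (omegat F).
  by rewrite rmorphB rmorph_sum /=; under eq_bigr do rewrite omegat_hop.
by move=> /subr0_eq e /subr0_eq ->; rewrite -e.
Qed.

End AdamsOmega.

Theorem lemma2p1p1 (R : preLambdaRingType) (R_tf : torsion_free R) :
  prelambda_map (@omegat R) /\
  (forall f : symser R, Fil 1 f -> omegat (Exp_sigma f) = Exp_sigma (omegat f)).
Proof.
split; last by move=> f; apply: omegat_Exp.
by split; [apply: omegatD | apply: omegatM | apply: omegat_hop].
Qed.
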